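(* Let $s\ge 1$ and let $R>1$, $N>1$, $q$, $p_1,\dots,p_s$ be positive integers with $\gcd(R,N)=1$ and $p_1<p_2<\cdots<p_s<q$. Let $M=RN^q$ and let $D$, $L$, $\Lambda$ and $\mu_{M,D}$ be as defined in the context. Suppose $t$ is a real number. Then $t\Lambda$ is a spectrum of $\mu_{M,D}$ if and only if $t$ is an integer with $\gcd(t,N)=1$ and, for every positive integer $n\le \#\{T(RN^q,tL)\cap\mathbb{Z}\}$, there is no word $I=i_1i_2\dots i_n$ with all $i_j\in L$ and $I\ne 0^n$ such that $$\big((RN^q)^n-1\big)\ \big|\ t\big(i_1+(RN^q)i_2+\cdots+(RN^q)^{n-1}i_n\big),$$ where $$T(RN^q,tL)=\left\{\sum_{j=1}^{\infty}(RN^q)^{-j}c_j : c_j\in tL \text{ for all } j\ge 1\right\}.$$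
   Context: $A\oplus B=\{a+b: a\in A, b\in B\}$ denotes the sumset, where all sums are distinct. The sets are $$D=\{0,\dots,N-1\}\oplus N^{p_1}\{0,\dots,N-1\}\oplus\cdots\oplus N^{p_s}\{0,\dots,N-1\},$$ $$L=RN^q\left(\tfrac{1}{N}\{0,\dots,N-1\}\oplus\tfrac{1}{N^{p_1+1}}\{0,\dots,N-1\}\oplus\cdots\oplus\tfrac{1}{N^{p_s+1}}\{0,\dots,N-1\}\right)\subset\mathbb{Z},$$ $$\Lambda=\left\{\sum_{j=1}^{k}(RN^q)^{j-1}l_j : k\ge 1 \text{ and all } l_j\in L\right\}.$$ The self-similar measure $\mu_{M,D}$ is the unique Borel probability measure on $\mathbb{R}$ satisfying $\mu_{M,D}(E)=\frac{1}{\#D}\sum_{d\in D}\mu_{M,D}(\tau_d^{-1}(E))$ for every Borel set $E\subset\mathbb{R}$, where $\tau_d(x)=M^{-1}(x+d)$; it is compactly supported. A countable set $\Gamma\subset\mathbb{R}$ is a spectrum of a Borel probability measure $\mu$ if $\{e^{2\pi i\gamma x}:\gamma\in\Gamma\}$ is an orthonormal basis of $L^2(\mu)$. $0^n$ denotes the word consisting of $n$ zeros. *)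

(* Defs.v *)
From HB Require Import structures.
From mathcomp Require Import all_boot all_order all_algebra finmap.
From mathcomp Require Import all_classical all_reals all_analysis.
From mathcomp Require Import complex.

Set Implicit Arguments.
Unset Strict Implicit.
Unset Printing Implicit Defensive.

Import Order.TTheory GRing.Theory Num.Theory.
Import numFieldNormedType.Exports.

Local Open Scope classical_set_scope.
Local Open Scope ring_scope.
Local Open Scope complex_scope.

Section digit_sets.
Variable F : realType.

Definition sumset (A B : {fset F}) : {fset F} :=
  [fset (a + b)%R | a in A, b in B]%fset.

Definition digits (N : nat) (c : F) : {fset F} :=
  [fset (c * k%:R)%R | k in iota 0 N]%fset.

(* When 0 < p_1 < ... < p_s, uniqueness of base-N expansions makes the iterated
   sumsets in [Dset] and [Lset] direct, so directness is not imposed. *)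
Definition Dset (N s : nat) (p : 'I_s -> nat) : {fset F} :=
  sumset (digits N 1)
    (\big[sumset/[fset 0%R]%fset]_(i < s) digits N ((N ^ p i)%N%:R)).

Definition Lset (R N q s : nat) (p : 'I_s -> nat) : {fset F} :=
  [fset ((R * N ^ q)%N%:R * x)%R | x in
    sumset (digits N N%:R^-1)%R
      (\big[sumset/[fset 0%R]%fset]_(i < s) digits N ((N ^ (p i).+1)%N%:R^-1)%R)]%fset.

Definition dilate (t : F) (A : set F) : set F := [set t * a | a in A].

(* The indices are shifted: [l j] is the digit l_(j+1). *)
Definition expansions (b : F) (L : set F) : set F :=
  [set x | exists (k : nat) (l : 'I_k -> F),
     [/\ (1 <= k)%N, forall j, L (l j) & x = \sum_(j < k) b ^+ j * l j]].

Definition attractor (b : F) (C : set F) : set F :=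
  [set x | exists2 c : nat -> F, (forall j, C (c j)) &
     (series (fun j => b ^- j.+1 * c j) : nat -> F) @ \oo --> x].

End digit_sets.

Section spectra.
Variable F : realType.

Definition ifs_map (M d x : F) : F := M^-1 * (x + d).

Variable mu : probability (measurableTypeR F) F.

Definition self_similar (M : F) (D : {fset F}) :=
  forall E : set (measurableTypeR F), measurable E ->
    (mu E = (#|` D|%:R^-1)%:E *
            \sum_(d <- D) mu (ifs_map M d @^-1` E))%E.

Definition Lnorm2 (f : F -> F[i]) : \bar F :=
  Lnorm mu 2%:E (fun x => (ComplexField.Normc.normc (f x))%:E).

Definition L2fun (f : F -> F[i]) : Prop :=
  [/\ measurable_fun [set: measurableTypeR F] (fun x => complex.Re (f x)),
      measurable_fun [set: measurableTypeR F] (fun x => complex.Im (f x)) &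
      (Lnorm2 f < +oo)%E].

Definition inner (f g : F -> F[i]) : F[i] :=
  let h x := f x * (g x)^* in
  (\int[mu]_x complex.Re (h x))%R +i* (\int[mu]_x complex.Im (h x))%R.

(* Elements of L^2(mu) are represented by functions; a family is an
   orthonormal basis when it is orthonormal and its finite complex linear
   combinations are dense. *)
Definition orthonormal_basis (T : choiceType) (G : set T)
    (e : T -> F -> F[i]) : Prop :=
  [/\ forall a, G a -> L2fun (e a),
      forall a b, G a -> G b -> inner (e a) (e b) = (a == b)%:R &
      forall f, L2fun f -> forall eps : F, 0 < eps ->
        exists (X : {fset T}) (c : T -> F[i]),
          [set` X] `<=` G /\
          (Lnorm2 (fun x => (f x - \sum_(a <- X) c a * e a x)%R) < eps%:E)%E].

Definition expi (x : F) : F[i] := cos x +i* sin x.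

Definition spectrum (G : set F) : Prop :=
  countable G /\
  orthonormal_basis G (fun (gamma x : F) => expi (2 * pi * gamma * x)).

End spectra.

(* Main.v *)
(** Let ft be the Fourier transform of mu. Self-similarity gives ft(x) = m(x / M) ft(x / M),
    where the mask m is a product of geometric sums over the digits in D. Hence ft vanishes
    exactly at the x such that some x / M^(j+1) is a zero of m, and those zeros have the form
    a / N^(p_i + 1). If z is prime to N, then (D, zL) is a Hadamard pair, so the exponentials
    with frequencies in zL + M zL + ... + M^(n-1) zL are orthonormal, and the square norms
    Q_n(x) of the projections of the exponential of frequency -x onto their spans satisfy
    Q_(n+1) = T Q_n for the transfer operator T g(x) = sum_l |m(y_l)|^2 g(y_l), where
    y_l = (x + z l) / M. Completeness means that the increasing limit Q of the Q_n is 1.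

    Q attains a minimum on every large interval, and the minimizers are stable under the maps
    x -> y_l with m(y_l) <> 0. A minimizer that is not an integer is stable under iterated
    division by M, so Q is 1 there. If all minimizers are integers, they contain a cycle of
    x -> y_l, whose points are distinct integers of the attractor and whose word I satisfies
    the divisibility condition; by hypothesis I = 0, so 0 is a minimizer and Q(0) = 1.
    It then remains to know that the trigonometric polynomials are dense in L^2(mu).

    Conversely, each violation of the conditions on t exhibits a frequency orthogonal to the
    whole family. *)

Require Import Defs.
From HB Require Import structures.
From mathcomp Require Import all_boot all_order all_algebra finmap.
From mathcomp Require Import complex ring lra zify.
From mathcomp Require Import all_classical all_reals all_analysis.
From mathcomp Require Import measurable_realfun.

Set Implicit Arguments.
Unset Strict Implicit.
Unset Printing Implicit Defensive.

Import Order.TTheory GRing.Theory Num.Theory.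
Import numFieldNormedType.Exports.

Local Open Scope classical_set_scope.
Local Open Scope card_scope.
Local Open Scope ring_scope.

(** * Complex exponentials of period 1 and their geometric sums *)

Section exponentials.
Local Open Scope complex_scope.
Variable F : realType.
Implicit Types (x y : F) (z w : F[i]).

Definition sqn z : F := complex.Re z ^+ 2 + complex.Im z ^+ 2.

Lemma sqnE z : (sqn z)%:C = z * conjc z.
Proof.
case: z => a b; rewrite /sqn /=; apply/eqP; rewrite eq_complex /=.
by apply/andP; split; apply/eqP; ring.
Qed.

Lemma conjcM z w : conjc (z * w) = conjc z * conjc w.
Proof.
case: z w => a b [c d]; apply/eqP; rewrite eq_complex /=.
by apply/andP; split; apply/eqP; ring.
Qed.

Lemma conjc_sum (I : Type) (r : seq I) (f : I -> F[i]) :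
  conjc (\sum_(i <- r) f i) = \sum_(i <- r) conjc (f i).
Proof. exact: raddf_sum. Qed.

Lemma real_complex_sum (I : Type) (r : seq I) (f : I -> F) :
  (\sum_(i <- r) f i)%:C = \sum_(i <- r) (f i)%:C.
Proof. exact: raddf_sum. Qed.

Lemma sqn_ge0 z : 0 <= sqn z.
Proof. by rewrite addr_ge0 ?sqr_ge0. Qed.

Lemma sqnM z w : sqn (z * w) = sqn z * sqn w.
Proof. by case: z w => a b [c d]; rewrite /sqn /=; ring. Qed.

Lemma sqn0 : sqn 0 = 0 :> F.
Proof. by rewrite /sqn /= expr0n addr0. Qed.

Lemma sqn1 : sqn 1 = 1 :> F.
Proof. by rewrite /sqn /= expr0n addr0 expr1n. Qed.

Lemma sqn_conj z : sqn (conjc z) = sqn z.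
Proof. by case: z => a b; rewrite /sqn /= sqrrN. Qed.

Lemma sqn_real x : sqn x%:C = x ^+ 2.
Proof. by rewrite /sqn /= expr0n addr0. Qed.

Lemma sqn_eq0 z : (sqn z == 0) = (z == 0).
Proof. by case: z => a b; rewrite /sqn paddr_eq0 ?sqr_ge0 // !sqrf_eq0 eq_complex. Qed.

Lemma sqnD_le z w : sqn (z + w) <= 2 * sqn z + 2 * sqn w.
Proof.
case: z w => a b [c d]; rewrite /sqn /=.
by have := sqr_ge0 (a - c); have := sqr_ge0 (b - d); nra.
Qed.

Lemma normc_sqr z : ComplexField.Normc.normc z ^+ 2 = sqn z.
Proof. by case: z => a b; rewrite /= sqr_sqrtr // addr_ge0 ?sqr_ge0. Qed.

Definition cis y : F[i] := expi (2 * pi * y).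

Lemma cisD x y : cis (x + y) = cis x * cis y.
Proof.
rewrite /cis /expi mulrDr cosD sinD; apply/eqP; rewrite eq_complex /= eqxx /=.
by apply/eqP; ring.
Qed.

Lemma cis0 : cis 0 = 1.
Proof. by rewrite /cis /expi mulr0 cos0 sin0. Qed.

Lemma cisN y : cis (- y) = conjc (cis y).
Proof. by rewrite /cis /expi mulrN cosN sinN. Qed.

Lemma sqn_cis y : sqn (cis y) = 1.
Proof. by rewrite /sqn /= cos2Dsin2. Qed.

Lemma cisMn (k : nat) y : cis (k%:R * y) = cis y ^+ k.
Proof.
elim: k => [|k IH]; first by rewrite mul0r cis0 expr0.
by rewrite -natr1 mulrDl mul1r cisD IH exprSr.
Qed.

Lemma cis_int (k : int) : cis k%:~R = 1.
Proof.
have cn (n : nat) : cis n%:R = 1.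
  rewrite -[n%:R]mulr1 cisMn /cis /expi mulr1 mulr_natl cos2pi.
  by rewrite -[pi *+ 2]add0r sinD2pi sin0 expr1n.
case: k => n; first exact: cn.
rewrite NegzE mulrNz cisN; have := cn n.+1.
by rewrite pmulrn => ->; apply/eqP; rewrite eq_complex /= oppr0 !eqxx.
Qed.

Lemma cis_periodic y (k : int) : cis (y + k%:~R) = cis y.
Proof. by rewrite cisD cis_int mulr1. Qed.

(** Only the fractional part r of y matters, and 1 - cos(2 pi r) = 2 sin(pi r)^2 is positive for 0 <
    r < 1. *)
Lemma cis_eq1 y : cis y = 1 -> exists k : int, y = k%:~R.
Proof.
move=> h; exists (Num.floor y).
set r := y - (Num.floor y)%:~R.
have r0 : 0 <= r by rewrite subr_ge0 floor_le_tmp.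
have r1 : r < 1 by rewrite ltrBlDr addrC -[1]/(1%:~R) -intrD floorD1_gt.
have hr : cis r = 1 by rewrite /r -mulrNz cis_periodic.
have [r00|rn0] := eqVneq r 0; first by apply/eqP; rewrite -subr_eq0 -/r r00.
have rp : 0 < r by rewrite lt_def rn0.
have sp : 0 < sin (pi * r).
  by apply: sin_gt0_pi; rewrite mulr_gt0 ?pi_gt0 //= gtr_pMr ?pi_gt0.
move: hr => /eqP; rewrite eq_complex /= => /andP[/eqP hc _].
have : cos (2 * pi * r) = 1 - 2 * sin (pi * r) ^+ 2.
  have -> : 2 * pi * r = pi * r + pi * r by ring.
  by rewrite cosD; have := cos2Dsin2 (pi * r); nra.
by rewrite hc; have := exprn_gt0 2 sp; lra.
Qed.

Lemma geom_cis (N : nat) y :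
  (cis y - 1) * (\sum_(k < N) cis (k%:R * y)) = cis (N%:R * y) - 1.
Proof.
rewrite cisMn subrX1; congr (_ * _); apply: eq_bigr => k _; exact: cisMn.
Qed.

Lemma geom_cis_eq0 (N : nat) y (k : int) :
  N%:R * y = k%:~R -> ~ (exists j : int, y = j%:~R) ->
  \sum_(k < N) cis (k%:R * y) = 0.
Proof.
move=> hy nj; have := geom_cis N y; rewrite hy cis_int subrr => /eqP.
rewrite mulf_eq0 subr_eq0 => /orP[/eqP/cis_eq1//|/eqP//].
Qed.

Lemma geom_cis_int (N : nat) (k : int) :
  \sum_(j < N) cis (j%:R * k%:~R) = N%:R.
Proof.
rewrite (eq_bigr (fun=> 1)) ?sumr_const ?card_ord // => j _.
by rewrite pmulrn -intrM cis_int.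
Qed.

Lemma geom_cis_eq0_int (N : nat) y : (0 < N)%N ->
  \sum_(k < N) cis (k%:R * y) = 0 ->
  (exists k : int, N%:R * y = k%:~R) /\ ~ (exists j : int, y = j%:~R).
Proof.
move=> N0 h; split.
  apply: cis_eq1; apply/eqP; rewrite -subr_eq0 -geom_cis h mulr0 //.
case=> j yj; move: h; rewrite yj geom_cis_int => /eqP.
by rewrite pnatr_eq0; move: N0; case: N.
Qed.

End exponentials.

(** * Integration against mu, square norms and the Fourier transform *)

Section square_integrable.
Local Open Scope complex_scope.
Variable F : realType.
Variable mu : probability (measurableTypeR F) F.
Implicit Types (g : F -> F) (f h : F -> F[i]).

(** Bounded measurable functions are stable under sums and products and integrable for the
    probability [mu], so the integral is linear on them without side conditions. *)
Definition bounded_mfun g :=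
  measurable_fun [set: measurableTypeR F] g /\ exists B, forall x, `|g x| <= B.

Lemma bounded_mfun_integrable g :
  bounded_mfun g -> mu.-integrable [set: measurableTypeR F] (EFin \o g).
Proof.
case=> mg [B hB]; apply: measurable_bounded_integrable => //.
  by rewrite [X in (X < _)%E](probability_setT mu) ltry.
exists B; split; first by rewrite num_real.
by move=> y By x _; exact: le_trans (hB x) (ltW By).
Qed.

Lemma bounded_mfunD g1 g2 : bounded_mfun g1 -> bounded_mfun g2 ->
  bounded_mfun (fun x => g1 x + g2 x).
Proof.
move=> [m1 [B1 h1]] [m2 [B2 h2]]; split; first exact: measurable_funD.
by exists (B1 + B2) => x; rewrite (le_trans (ler_normD _ _)) // lerD.
Qed.

Lemma bounded_mfunM g1 g2 : bounded_mfun g1 -> bounded_mfun g2 ->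
  bounded_mfun (fun x => g1 x * g2 x).
Proof.
move=> [m1 [B1 h1]] [m2 [B2 h2]]; split; first exact: measurable_funM.
by exists (B1 * B2) => x; rewrite normrM ler_pM.
Qed.

Lemma bounded_mfun_cst (c : F) : bounded_mfun (fun=> c).
Proof. by split; [exact: measurable_cst|exists `|c|]. Qed.

Lemma bounded_mfunN g : bounded_mfun g -> bounded_mfun (fun x => - g x).
Proof.
move=> [m1 [B1 h1]]; split; first exact: measurableT_comp.
by exists B1 => x; rewrite normrN.
Qed.

Definition cmeas f :=
  measurable_fun [set: measurableTypeR F] (fun x => complex.Re (f x)) /\
  measurable_fun [set: measurableTypeR F] (fun x => complex.Im (f x)).

Definition bmeas f :=
  bounded_mfun (fun x => complex.Re (f x)) /\
  bounded_mfun (fun x => complex.Im (f x)).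

Lemma bmeas_cmeas f : bmeas f -> cmeas f.
Proof. by case=> [[? _] [? _]]. Qed.

Lemma cmeasD f h : cmeas f -> cmeas h -> cmeas (fun x => f x + h x).
Proof.
move=> [f1 f2] [h1 h2]; split.
  apply: (eq_measurable_fun (fun x => complex.Re (f x) + complex.Re (h x))).
    by move=> x _; case: (f x) (h x) => ? ? [].
  exact: measurable_funD.
apply: (eq_measurable_fun (fun x => complex.Im (f x) + complex.Im (h x))).
  by move=> x _; case: (f x) (h x) => ? ? [].
exact: measurable_funD.
Qed.

Lemma bmeasD f h : bmeas f -> bmeas h -> bmeas (fun x => f x + h x).
Proof.
move=> [f1 f2] [h1 h2]; split.
  have := bounded_mfunD f1 h1; congr bounded_mfun; apply/funext => x.
  by case: (f x) (h x) => ? ? [].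
have := bounded_mfunD f2 h2; congr bounded_mfun; apply/funext => x.
by case: (f x) (h x) => ? ? [].
Qed.

Lemma bmeasM f h : bmeas f -> bmeas h -> bmeas (fun x => f x * h x).
Proof.
move=> [f1 f2] [h1 h2]; split.
  have := bounded_mfunD (bounded_mfunM f1 h1) (bounded_mfunN (bounded_mfunM f2 h2)).
  congr bounded_mfun; apply/funext => x.
  by case: (f x) (h x) => ? ? [].
have := bounded_mfunD (bounded_mfunM f1 h2) (bounded_mfunM f2 h1).
congr bounded_mfun; apply/funext => x.
by case: (f x) (h x) => ? ? [].
Qed.

Lemma bmeas_conj f : bmeas f -> bmeas (fun x => (conjc (f x))).
Proof.
move=> [f1 f2]; split.
  by move: f1; congr bounded_mfun; apply/funext => x; case: (f x).
by have := bounded_mfunN f2; congr bounded_mfun; apply/funext => x; case: (f x).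
Qed.

Lemma bmeas_cst (c : F[i]) : bmeas (fun=> c).
Proof. by split; exact: bounded_mfun_cst. Qed.

Lemma bmeasN f : bmeas f -> bmeas (fun x => - f x).
Proof.
move=> hf; have := bmeasM (bmeas_cst (-1)) hf; congr bmeas.
by apply/funext => x; rewrite mulN1r.
Qed.

Lemma bmeas_sum (I : Type) (r : seq I) (f : I -> F -> F[i]) :
  (forall i, bmeas (f i)) -> bmeas (fun x => \sum_(i <- r) f i x).
Proof.
move=> hf; elim: r => [|i r IH].
  by under eq_fun do rewrite big_nil; exact: bmeas_cst.
by under eq_fun do rewrite big_cons; exact: bmeasD.
Qed.

Lemma measurable_cos_lin (a : F) :
  measurable_fun [set: measurableTypeR F] (fun x => cos (a * x)).
Proof.
apply: continuous_measurable_fun => x; apply: (@continuous_comp _ _ _ (fun x : F => a * x) cos).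
  exact: mulrl_continuous.
exact: continuous_cos.
Qed.

Lemma measurable_sin_lin (a : F) :
  measurable_fun [set: measurableTypeR F] (fun x => sin (a * x)).
Proof.
apply: continuous_measurable_fun => x; apply: (@continuous_comp _ _ _ (fun x : F => a * x) sin).
  exact: mulrl_continuous.
exact: continuous_sin.
Qed.

Lemma bmeas_cis (a : F) : bmeas (fun x => cis (a * x)).
Proof.
split; (split; last exists 1 => x;
  rewrite /= ?cos_le1 ?ler_norml ?cos_geN1 ?cos_le1 ?sin_geN1 ?sin_le1 //).
- apply: (eq_measurable_fun (fun x => cos (2 * pi * a * x))).
    by move=> x _ /=; rewrite mulrA.
  exact: measurable_cos_lin.
- apply: (eq_measurable_fun (fun x => sin (2 * pi * a * x))).
    by move=> x _ /=; rewrite mulrA.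
  exact: measurable_sin_lin.
Qed.

Definition cint f : F[i] :=
  (\int[mu]_x complex.Re (f x))%R +i* (\int[mu]_x complex.Im (f x))%R.

Lemma eq_cint f h : f =1 h -> cint f = cint h.
Proof. by move=> /funext ->. Qed.

Lemma cintD f h : bmeas f -> bmeas h ->
  cint (fun x => f x + h x) = cint f + cint h.
Proof.
move=> [f1 f2] [h1 h2]; rewrite /cint; apply/eqP; rewrite eq_complex /=.
have i := bounded_mfun_integrable.
rewrite -(RintegralD _ (i _ f1) (i _ h1)) // -(RintegralD _ (i _ f2) (i _ h2)) //.
by apply/andP; split; apply/eqP; apply: eq_Rintegral => x _; case: (f x) (h x) => ? ? [].
Qed.

Lemma cintZ (c : F[i]) f : bmeas f -> cint (fun x => c * f x) = c * cint f.
Proof.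
case: c => a b [f1 f2]; rewrite /cint; apply/eqP; rewrite eq_complex /=.
have i := bounded_mfun_integrable.
have im c g : bounded_mfun g -> bounded_mfun (fun x => c * g x).
  by move=> hg; exact: (bounded_mfunM (bounded_mfun_cst c)).
rewrite -!RintegralZl ?i //.
rewrite -RintegralB //; [|exact/i/im..].
rewrite -RintegralD //; [|exact/i/im..].
by apply/andP; split; apply/eqP; apply: eq_Rintegral => x _; case: (f x).
Qed.

Lemma cint_sum (I : Type) (r : seq I) (f : I -> F -> F[i]) :
  (forall i, bmeas (f i)) ->
  cint (fun x => \sum_(i <- r) f i x) = \sum_(i <- r) cint (f i).
Proof.
move=> hf; elim: r => [|i r IH].
  rewrite big_nil; under eq_fun do rewrite big_nil.
  by rewrite /cint /= !Rintegral_cst // !mul0r.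
rewrite big_cons -IH -cintD //; last exact: bmeas_sum.
by apply: eq_cint => x; rewrite big_cons.
Qed.

Lemma cint_conj f : bmeas f -> cint (fun x => (conjc (f x))) = (conjc (cint f)).
Proof.
move=> [f1 f2]; rewrite /cint; apply/eqP; rewrite eq_complex /=.
apply/andP; split; apply/eqP; first by apply: eq_Rintegral => x _; case: (f x).
rewrite -mulN1r -RintegralZl ?bounded_mfun_integrable //.
by apply: eq_Rintegral => x _; case: (f x) => ? ?; rewrite mulN1r.
Qed.

Lemma cint_cst (c : F[i]) : cint (fun=> c) = c.
Proof.
have e := congr1 fine (probability_setT mu).
rewrite /cint !Rintegral_cst // e /= !mulr1.
by case: c.
Qed.

(** The square of the L^2 norm ([n2_Lnorm2]), extended real because f is arbitrary; working with
    squares avoids roots. *)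
Definition n2 f : \bar F := (\int[mu]_x (sqn (f x))%:E)%E.

Lemma measurable_sqn f : cmeas f ->
  measurable_fun [set: measurableTypeR F] (fun x => sqn (f x)).
Proof. by move=> [h1 h2]; apply: measurable_funD; apply: measurable_funX. Qed.

Lemma n2_ge0 f : (0 <= n2 f)%E.
Proof. by apply: integral_ge0 => x _; rewrite lee_fin sqn_ge0. Qed.

Lemma n2E f : bmeas f -> n2 f = (complex.Re (cint (fun x => f x * conjc (f x))))%:E.
Proof.
move=> hf; have [[h h'] _] := bmeasM hf (bmeas_conj hf).
have e : (fun x => complex.Re (f x * conjc (f x))) = fun x => sqn (f x).
  by apply/funext => x; rewrite -sqnE.
transitivity ((\int[mu]_x sqn (f x))%R%:E); last by rewrite -e.
rewrite /Rintegral fineK //.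
apply: integrable_fin_num => //; apply: bounded_mfun_integrable.
by rewrite -e.
Qed.

(** A substitute for the triangle inequality on squared norms, from |a + b|^2 <= 2|a|^2 + 2|b|^2
    pointwise. *)
Lemma n2D_le f h : cmeas f -> cmeas h ->
  (n2 (fun x => (f x + h x)%R) <= 2%:E * n2 f + 2%:E * n2 h)%E.
Proof.
move=> mf mh; have mf' := measurable_sqn mf; have mh' := measurable_sqn mh.
have nn k x : (0 <= (sqn (k x : F[i]))%:E)%E by rewrite lee_fin sqn_ge0.
rewrite /n2 -ge0_integralZl //; [|exact/measurable_EFinP].
rewrite -ge0_integralZl //; [|exact/measurable_EFinP].
rewrite -ge0_integralD //; first last.
- by apply/measurable_funeM/measurable_EFinP.
- by move=> x _; rewrite mule_ge0.
- by apply/measurable_funeM/measurable_EFinP.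
- by move=> x _; rewrite mule_ge0.
apply: ge0_le_integral => //.
- by apply/measurable_EFinP; apply: measurable_sqn; exact: cmeasD.
- by apply: emeasurable_funD; apply: measurable_funeM; apply/measurable_EFinP.
- by move=> x _; rewrite -!EFinM -EFinD lee_fin sqnD_le.
Qed.

Definition ft (xi : F) : F[i] := cint (fun x => cis (xi * x)).

Lemma ft0 : ft 0 = 1.
Proof.
by rewrite /ft -[RHS]cint_cst; apply: eq_cint => x; rewrite mul0r cis0.
Qed.

Lemma cint_cis_conj (a b : F) :
  cint (fun x => cis (a * x) * conjc (cis (b * x))) = ft (a - b).
Proof. by apply: eq_cint => x; rewrite -cisN -cisD mulrBl. Qed.

(** With c the mean of f, the variance identity n2(f - c) = n2(f) - |c|^2 has a nonnegative
    left-hand side. *)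
Lemma sqn_cint_le f : bmeas f -> ((sqn (cint f))%:E <= n2 f)%E.
Proof.
move=> hf; pose c := cint f; pose h x := f x - c.
have hh : bmeas h by apply: bmeasD => //; exact: bmeas_cst.
have hc := bmeas_cst (- c).
have hcc := bmeas_conj hc.
have hfc := bmeas_conj hf.
have : (0 <= n2 h)%E := n2_ge0 h.
rewrite (n2E hf) (n2E hh).
have -> : cint (fun x => h x * conjc (h x)) =
    cint (fun x => f x * conjc (f x)) - (sqn c)%:C.
  transitivity (cint (fun x => f x * conjc (f x) +
    ((- c) * conjc (f x) + ((conjc (- c)) * f x + (sqn c)%:C)))).
    apply: eq_cint => x; rewrite /h sqnE; case: (f x) (c) => u v [u' v'].
    by apply/eqP; rewrite eq_complex /=; apply/andP; split; apply/eqP; ring.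
  rewrite cintD; [|exact: bmeasM|]; last first.
    apply: bmeasD; first exact: bmeasM.
    by apply: bmeasD; [exact: bmeasM|exact: bmeas_cst].
  rewrite cintD; [|exact: bmeasM|]; last first.
    by apply: bmeasD; [exact: bmeasM|exact: bmeas_cst].
  rewrite cintD; [|exact: bmeasM|exact: bmeas_cst].
  rewrite !cintZ // cint_conj // cint_cst -/c.
  congr (_ + _); rewrite !sqnE; case: (c) => u v.
  by apply/eqP; rewrite eq_complex /=; apply/andP; split; apply/eqP; ring.
rewrite !lee_fin raddfB /= -/c; lra.
Qed.

(** Pythagoras: the coefficients [ft (xi - a i)] are the inner products of the exponential of
    frequency xi with an orthonormal family, so the cross term and the square of the sum both equal
    the sum of their squared moduli. *)
Lemma n2_projection (I : finType) (xi : F) (a : I -> F) :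
  (forall i j, i != j -> ft (a i - a j) = 0) ->
  n2 (fun x => cis (xi * x) - \sum_i ft (xi - a i) * cis (a i * x)) =
  (1 - \sum_i sqn (ft (xi - a i)))%:E.
Proof.
move=> ort; set c := fun i => ft (xi - a i).
have bs : bmeas (fun x => \sum_i c i * cis (a i * x)).
  apply: bmeas_sum => i; apply: bmeasM; [exact: bmeas_cst|exact: bmeas_cis].
have bcs := bmeas_conj bs.
have bx := bmeas_cis xi; have bcx := bmeas_conj bx.
have key (b : F) : cint (fun x => cis (b * x) * conjc (\sum_i c i * cis (a i * x))) =
    \sum_i (conjc (c i)) * ft (b - a i).
  transitivity (cint (fun x => \sum_i (conjc (c i)) * (cis (b * x) * conjc (cis (a i * x))))).
    apply: eq_cint => x; rewrite conjc_sum mulr_sumr; apply: eq_bigr => i _.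
    by rewrite conjcM mulrCA.
  have bb i : bmeas (fun x => cis (b * x) * conjc (cis (a i * x))).
    by apply: bmeasM; [exact: bmeas_cis|apply: bmeas_conj; exact: bmeas_cis].
  rewrite cint_sum => [|i]; last by apply: bmeasM => //; exact: bmeas_cst.
  by apply: eq_bigr => i _; rewrite cintZ // cint_cis_conj.
have k1 : cint (fun x => cis (xi * x) * conjc (\sum_i c i * cis (a i * x))) =
    (\sum_i sqn (c i))%:C.
  by rewrite key real_complex_sum; apply: eq_bigr => i _; rewrite sqnE mulrC.
have k2 : cint (fun x => (\sum_i c i * cis (a i * x)) * conjc (\sum_i c i * cis (a i * x))) =
    (\sum_i sqn (c i))%:C.
  transitivity (cint (fun x =>
      \sum_i c i * (cis (a i * x) * conjc (\sum_i c i * cis (a i * x))))).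
    by apply: eq_cint => x; rewrite mulr_suml; apply: eq_bigr => i _; rewrite mulrA.
  have bb i : bmeas (fun x => cis (a i * x) * conjc (\sum_i c i * cis (a i * x))).
    by apply: bmeasM => //; exact: bmeas_cis.
  rewrite cint_sum => [|i]; last by apply: bmeasM => //; exact: bmeas_cst.
  rewrite real_complex_sum; apply: eq_bigr => i _; rewrite cintZ // key (bigD1 i) //=.
  rewrite big1 => [|j ji]; last by rewrite ort ?mulr0 // eq_sym.
  by rewrite subrr ft0 mulr1 addr0 sqnE.
rewrite n2E; last by apply: bmeasD => //; exact: bmeasN.
congr EFin.
set S := fun x => \sum_i c i * cis (a i * x).
transitivity (complex.Re (cint (fun x => 1 + (-1) * (cis (xi * x) * conjc (S x)) +
   ((-1) * conjc (cis (xi * x) * conjc (S x)) + S x * conjc (S x))))).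
  congr complex.Re; apply: eq_cint => x; rewrite -/(S x).
  have : cis (xi * x) * conjc (cis (xi * x)) = 1 by rewrite -sqnE sqn_cis.
  move: (cis (xi * x)) (S x) => [u v] [u' v'] /eqP.
  rewrite eq_complex /= => /andP[/eqP h1 /eqP h2].
  by apply/eqP; rewrite eq_complex /=; apply/andP; split; apply/eqP; lra.
have b1 := bmeasM bx bcs.
have b1' := bmeas_conj b1.
have b2 := bmeasM bs bcs.
have bm1 := bmeas_cst (-1).
have b0 := bmeas_cst 1.
rewrite cintD; [|by apply: bmeasD => //; exact: bmeasM..].
rewrite !cintD //; try exact: bmeasM.
rewrite !cintZ // cint_conj // cint_cst k1 k2 /=.
by rewrite oppr0 !mul0r; ring.
Qed.

(** Multiplying by the conjugate of [cis (xi * x)], of modulus 1, keeps the norm and turns the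
    difference into a function of mean 1; then [sqn_cint_le] applies. *)
Lemma n2_orthogonal (xi : F) (X : seq F) (c : F -> F[i]) :
  (forall a, a \in X -> ft (xi - a) = 0) ->
  (1 <= n2 (fun x => (cis (xi * x) - \sum_(a <- X) c a * cis (a * x))%R))%E.
Proof.
move=> ort; set S := fun x => \sum_(a <- X) c a * cis (a * x).
have bs : bmeas S.
  by apply: bmeas_sum => i; apply: bmeasM; [exact: bmeas_cst|exact: bmeas_cis].
have bx := bmeas_cis xi; have bcx := bmeas_conj bx.
have bd : bmeas (fun x => cis (xi * x) - S x) by apply: bmeasD => //; exact: bmeasN.
have b2 : bmeas (fun x => (cis (xi * x) - S x) * conjc (cis (xi * x))) by exact: bmeasM.
have -> : n2 (fun x => cis (xi * x) - S x) =
          n2 (fun x => (cis (xi * x) - S x) * conjc (cis (xi * x))).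
  by apply: eq_integral => x _; rewrite sqnM sqn_conj sqn_cis mulr1.
apply: le_trans (sqn_cint_le b2).
rewrite (_ : cint _ = 1) ?sqn1 //.
transitivity (cint (fun x =>
    1 + (-1) * \sum_(a <- X) c a * (cis (a * x) * conjc (cis (xi * x))))).
  apply: eq_cint => x; rewrite mulrBl -sqnE sqn_cis mulN1r; congr (_ - _).
  by rewrite mulr_suml; apply: eq_bigr => i _; rewrite mulrA.
have bb a : bmeas (fun x => c a * (cis (a * x) * conjc (cis (xi * x)))).
  by apply: bmeasM; [exact: bmeas_cst|apply: bmeasM => //; exact: bmeas_cis].
have bbs : bmeas (fun x => \sum_(a <- X) c a * (cis (a * x) * conjc (cis (xi * x)))).
  exact: bmeas_sum.
rewrite cintD; [|exact: bmeas_cst|]; last by apply: bmeasM => //; exact: bmeas_cst.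
rewrite cintZ // cint_cst cint_sum // big1_seq ?mulr0 ?addr0 // => a /= aX.
rewrite cintZ; last by apply: bmeasM => //; exact: bmeas_cis.
rewrite cint_cis_conj -opprB.
have -> : ft (- (xi - a)) = (conjc (ft (xi - a))).
  rewrite -cint_conj; last exact: bmeas_cis.
  by apply: eq_cint => x; rewrite mulNr cisN.
by rewrite ort // conjc0 mulr0.
Qed.

Lemma inner_cis (a b : F) :
  inner mu (fun x => expi (2 * pi * a * x)) (fun x => expi (2 * pi * b * x)) = ft (a - b).
Proof.
by rewrite -cint_cis_conj; apply: eq_cint => x; rewrite /cis !mulrA.
Qed.

Lemma n2_Lnorm2 f : n2 f = (Lnorm2 mu f `^ 2)%E.
Proof.
rewrite /Lnorm2 poweR_Lnorm ?pnatr_eq0 //; apply: eq_integral => x _ /=.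
by rewrite powR_mulrn ?normr_ge0 // real_normK ?num_real // normc_sqr.
Qed.

Lemma Lnorm2_ge0 f : (0 <= Lnorm2 mu f)%E.
Proof. exact: Lnorm_ge0. Qed.

Lemma Lnorm2_lt f (eps : F) : 0 < eps ->
  (Lnorm2 mu f < eps%:E)%E = (n2 f < (eps ^+ 2)%:E)%E.
Proof.
move=> e0; rewrite n2_Lnorm2.
have := Lnorm2_ge0 f; case: (Lnorm2 mu f) => [r||] //=.
  rewrite lee_fin !lte_fin => r0; rewrite powR_mulrn // ltr_pXn2r // nnegrE ltW //.
by rewrite pnatr_eq0 /= !ltNge !leey.
Qed.

Lemma L2funP f : L2fun mu f <-> cmeas f /\ (n2 f < +oo)%E.
Proof.
have eq : (Lnorm2 mu f < +oo)%E = (n2 f < +oo)%E.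
  rewrite n2_Lnorm2; have := Lnorm2_ge0 f; case: (Lnorm2 mu f) => [r||] //=.
    by rewrite !ltry.
  by rewrite pnatr_eq0 /=.
by split=> [[h1 h2 h3]|[[h1 h2] h3]]; split; rewrite -?eq // eq.
Qed.

Lemma n2_cst (c : F[i]) : n2 (fun=> c) = (sqn c)%:E.
Proof. by rewrite n2E ?cint_cst -?sqnE //; exact: bmeas_cst. Qed.

End square_integrable.

(** * Closed spans of exponentials in L^2(mu) *)

Section closed_spans.
Local Open Scope complex_scope.
Variable F : realType.
Variable mu : probability (measurableTypeR F) F.
Implicit Types (G : set F) (f g h : F -> F[i]).

(** A sequence of coefficient-frequency pairs may repeat a frequency, so sums and products of
    combinations need no merging. *)
Definition cis_span G f := exists s : seq (F[i] * F),
  (forall c, c \in s -> G c.2) /\ f = fun x => \sum_(c <- s) c.1 * cis (c.2 * x).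

Lemma cis_span_cis G (a : F) : G a -> cis_span G (fun x => cis (a * x)).
Proof.
move=> Ga; exists [:: (1, a)]; split; first by move=> c; rewrite inE => /eqP ->.
by apply/funext => x; rewrite big_seq1 mul1r.
Qed.

Lemma cis_span0 G : cis_span G (fun=> 0).
Proof. by exists [::]; split=> //; apply/funext => x; rewrite big_nil. Qed.

Lemma cis_spanD G f g : cis_span G f -> cis_span G g -> cis_span G (fun x => f x + g x).
Proof.
move=> [s [hs ->]] [r [hr ->]]; exists (s ++ r); split.
  by move=> c; rewrite mem_cat => /orP[/hs|/hr].
by apply/funext => x; rewrite big_cat.
Qed.

Lemma cis_spanZ G (a : F[i]) f : cis_span G f -> cis_span G (fun x => a * f x).
Proof.
move=> [s [hs ->]]; exists [seq (a * c.1, c.2) | c <- s]; split.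
  by move=> c /mapP[d /hs ? ->].
by apply/funext => x; rewrite big_map mulr_sumr; apply: eq_bigr => c _ /=; rewrite mulrA.
Qed.

Lemma cis_span_cst (a : F[i]) : cis_span setT (fun=> a).
Proof.
have := cis_spanZ a (cis_span_cis (I : setT (0 : F))); congr cis_span.
by apply/funext => x; rewrite mul0r cis0 mulr1.
Qed.

Lemma cis_spanM f g :
  cis_span setT f -> cis_span setT g -> cis_span setT (fun x => f x * g x).
Proof.
move=> [s [_ ->]] [r [_ ->]].
exists [seq (c.1 * d.1, c.2 + d.2) | c <- s, d <- r]; split=> //.
apply/funext => x; rewrite big_allpairs_dep mulr_suml; apply: eq_bigr => c _.
by rewrite mulr_sumr; apply: eq_bigr => d _ /=; rewrite mulrDl cisD; ring.
Qed.

Lemma cis_span_bmeas G f : cis_span G f -> bmeas f.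
Proof.
move=> [s [_ ->]]; apply: bmeas_sum => c.
by apply: bmeasM; [exact: bmeas_cst|exact: bmeas_cis].
Qed.

Definition approximable G f := cmeas f /\ forall eps : F, 0 < eps ->
  exists2 g, cis_span G g & (n2 mu (fun x => (f x - g x)%R) < eps%:E)%E.

Lemma cis_span_approximable G f : cis_span G f -> approximable G f.
Proof.
move=> hf; split; first exact/bmeas_cmeas/(cis_span_bmeas hf).
move=> eps e0; exists f => //; under eq_fun do rewrite subrr.
by rewrite n2_cst sqn0 lte_fin.
Qed.

Lemma cmeasN f : cmeas f -> cmeas (fun x => - f x).
Proof.
move=> [h1 h2]; split.
  apply: (eq_measurable_fun (fun x => - complex.Re (f x))).
    by move=> x _; case: (f x).
  exact: measurableT_comp.
apply: (eq_measurable_fun (fun x => - complex.Im (f x))).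
  by move=> x _; case: (f x).
exact: measurableT_comp.
Qed.

Lemma cmeasB f g : cmeas f -> cmeas g -> cmeas (fun x => f x - g x).
Proof. by move=> hf hg; apply: cmeasD => //; exact: cmeasN. Qed.

Lemma cmeasZ (a : F[i]) f : cmeas f -> cmeas (fun x => a * f x).
Proof.
case: a => a b [h1 h2]; split.
  apply: (eq_measurable_fun (fun x => a * complex.Re (f x) - b * complex.Im (f x))).
    by move=> x _; case: (f x).
  apply: measurable_funB; exact: measurable_funM.
apply: (eq_measurable_fun (fun x => a * complex.Im (f x) + b * complex.Re (f x))).
  by move=> x _; case: (f x).
apply: measurable_funD; exact: measurable_funM.
Qed.

Lemma n2Z (a : F[i]) f : cmeas f -> n2 mu (fun x => a * f x) = ((sqn a)%:E * n2 mu f)%E.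
Proof.
move=> hf; rewrite /n2 -ge0_integralZl ?lee_fin ?sqn_ge0 //.
- by apply: eq_integral => x _; rewrite sqnM EFinM.
- by apply/measurable_EFinP; exact: measurable_sqn.
- by move=> x _; rewrite lee_fin sqn_ge0.
Qed.

Lemma n2_sum_lt f g (eps : F) : cmeas f -> cmeas g ->
  (n2 mu f < (eps / 4)%:E)%E -> (n2 mu g < (eps / 4)%:E)%E ->
  (n2 mu (fun x => (f x + g x)%R) < eps%:E)%E.
Proof.
move=> mf mg hf hg; apply: le_lt_trans (n2D_le mu mf mg) _.
have -> : eps%:E = (2%:E * (eps / 4)%:E + 2%:E * (eps / 4)%:E)%E.
  by rewrite -!EFinM -EFinD; congr EFin; field.
by apply: lteD; rewrite lte_pmul2l // lte_fin.
Qed.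

Lemma approximable_closed G f : cmeas f -> (forall eps : F, 0 < eps ->
  exists2 g, approximable G g & (n2 mu (fun x => (f x - g x)%R) < eps%:E)%E) ->
  approximable G f.
Proof.
move=> mf H; split=> // eps e0.
have e4 : 0 < eps / 4 by lra.
have [g [mg hg] gf] := H _ e4; have [k sk kg] := hg _ e4.
exists k => //; have mk := bmeas_cmeas (cis_span_bmeas sk).
have := n2_sum_lt (cmeasB mf mg) (cmeasB mg mk) gf kg.
by under eq_fun do rewrite addrA subrK.
Qed.

Lemma approximableD G f g :
  approximable G f -> approximable G g -> approximable G (fun x => f x + g x).
Proof.
move=> [mf hf] [mg hg]; split; first exact: cmeasD.
move=> eps e0; have e4 : 0 < eps / 4 by lra.
have [k sk kf] := hf _ e4; have [l sl lg] := hg _ e4.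
exists (fun x => k x + l x); first exact: cis_spanD.
have := n2_sum_lt (cmeasB mf (bmeas_cmeas (cis_span_bmeas sk)))
  (cmeasB mg (bmeas_cmeas (cis_span_bmeas sl))) kf lg.
by under eq_fun do rewrite addrACA -opprD.
Qed.

Lemma approximableZ G (a : F[i]) f : approximable G f -> approximable G (fun x => a * f x).
Proof.
move=> [mf hf]; split; first exact: cmeasZ.
move=> eps e0; have a0 := sqn_ge0 a.
(* The added 1 keeps the denominator positive when a = 0. *)
have e4 : 0 < eps / (sqn a + 1) by rewrite divr_gt0 // ltr_wpDl.
have [k sk kf] := hf _ e4.
exists (fun x => a * k x); first exact: cis_spanZ.
under eq_fun do rewrite -mulrBr.
rewrite n2Z; last exact: cmeasB mf (bmeas_cmeas (cis_span_bmeas sk)).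
apply: (@le_lt_trans _ _ ((sqn a)%:E * (eps / (sqn a + 1))%:E)%E).
  by apply: lee_wpmul2l; [rewrite lee_fin|exact: ltW].
rewrite -EFinM lte_fin mulrA ltr_pdivrMr ?ltr_wpDl //.
by rewrite mulrC ltr_pM2l // ltrDl.
Qed.

Lemma approximable0 G : approximable G (fun=> 0).
Proof. exact/cis_span_approximable/cis_span0. Qed.

Lemma approximable_sum G (I : Type) (r : seq I) (f : I -> F -> F[i]) :
  (forall i, approximable G (f i)) -> approximable G (fun x => \sum_(i <- r) f i x).
Proof.
move=> hf; elim: r => [|i r IH].
  by under eq_fun do rewrite big_nil; exact: approximable0.
by under eq_fun do rewrite big_cons; exact: approximableD.
Qed.

Lemma approximable_trans G f :
  (forall a, approximable G (fun x => cis (a * x))) ->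
  approximable setT f -> approximable G f.
Proof.
move=> hG [mf hf]; apply: approximable_closed => // eps e0.
have [g [s [_ gE]] gf] := hf _ e0; exists g => //; rewrite gE.
by apply: approximable_sum => c; exact: approximableZ.
Qed.

(** Dominated convergence makes the squared distances from f to [h n] tend to 0, and approximability
    is a closed condition. *)
Lemma approximable_dominated G (h : nat -> F -> F[i]) f (k : F -> F) :
  (forall n, approximable G (h n)) -> cmeas f ->
  mu.-integrable [set: measurableTypeR F] (EFin \o k) ->
  (forall n x, sqn (f x - h n x) <= k x) ->
  (forall x, (fun n => sqn (f x - h n x)) @ \oo --> 0) ->
  approximable G f.
Proof.
move=> hh mf ik hk cv; apply: approximable_closed => // eps e0.
have mB n := measurable_sqn (cmeasB mf (proj1 (hh n))).
have [||||| _ _] := @dominated_convergence _ _ _ mu [set: measurableTypeR F]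
    measurableT (fun n x => (sqn (f x - h n x))%:E) (fun=> 0%E) (EFin \o k).
- by move=> n; apply/measurable_EFinP.
- exact: measurable_cst.
- by apply: aeW => x _; apply/cvg_EFin; [exact: nearW|exact: cv].
- exact: ik.
- by apply: aeW => x n _; rewrite gee0_abs ?lee_fin ?sqn_ge0 ?hk.
rewrite integral0 => /fine_cvgP[fn].
move=> /cvgrPdist_lt /(_ _ e0) ev.
near \oo => n; exists (h n) => //.
have fi : (n2 mu (fun x => (f x - h n x)%R)) \is a fin_num by near: n.
rewrite -(fineK fi) lte_fin.
have : `|0 - fine (n2 mu (fun x => (f x - h n x)%R))| < eps by near: n.
by rewrite sub0r normrN; apply: le_lt_trans; exact: ler_norm.
Unshelve. all: by end_near.
Qed.

End closed_spans.

(** * Density of trigonometric polynomials in L^2(mu) *)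

Section trigonometric_density.
Local Open Scope complex_scope.
Variable F : realType.
Variable mu : probability (measurableTypeR F) F.
Implicit Types (g : F -> F).

Definition rapproximable g := approximable mu setT (fun x => (g x)%:C).

Lemma rapproximable_dominated (h : nat -> F -> F) g (k : F -> F) :
  (forall n, rapproximable (h n)) ->
  mu.-integrable [set: measurableTypeR F] (EFin \o k) ->
  (forall n x, (g x - h n x) ^+ 2 <= k x) ->
  (forall x, (fun n => h n x) @ \oo --> g x) ->
  rapproximable g.
Proof.
move=> hh ik hk cv.
have mg : measurable_fun [set: measurableTypeR F] g.
  apply: (@measurable_fun_cvg _ _ _ _ h) => [n|x _]; last exact: cv.
  by case: (hh n) => -[].
apply: (approximable_dominated (h := fun n x => (h n x)%:C) (k := k)) => //.
- by move=> n x; rewrite -rmorphB sqn_real.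
- move=> x; under eq_fun do rewrite -rmorphB sqn_real.
  have -> : 0 = (g x - g x) * (g x - g x) by rewrite subrr mul0r.
  apply: cvgM; (apply: cvgB; [exact: cvg_cst|exact: cv]).
Qed.

Lemma rapproximable_bounded (h : nat -> F -> F) g :
  (forall n, rapproximable (h n)) -> (forall n x, `|h n x| <= 1) ->
  (forall x, (fun n => h n x) @ \oo --> g x) ->
  rapproximable g.
Proof.
move=> hh hb cv.
have gb x : `|g x| <= 1.
  apply: (@closed_cvg _ _ \oo _ (fun n => `|h n x|) (fun y => y <= 1)) => //.
  - exact: nearW.
  - by apply: cvg_norm; exact: cv.
(* Both functions are bounded by 1, so the squared difference is at most 2^2. *)
apply: (rapproximable_dominated (k := fun=> 4) hh) => //.
  by apply: bounded_mfun_integrable; exact: bounded_mfun_cst.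
move=> n x; have := gb x; have := hb n x; rewrite !ler_norml.
by move=> /andP[? ?] /andP[? ?]; nra.
Qed.

(* Its iterates on [-1, 1] converge pointwise to the sign function. *)
Definition sharpen (w : F) := (3 * w - w ^+ 3) / 2.

(** With P = [sharpen], 1 - P(u) = (1 - u)^2 (2 + u) / 2 and 1 + P(u) = (1 + u)^2 (2 - u) / 2, both
    nonnegative on [-1, 1]. *)
Lemma iter_sharpen_le1 n w : `|w| <= 1 -> `|iter n sharpen w| <= 1.
Proof.
move=> hw; elim: n => //= n; rewrite /sharpen; move: (iter n _ w) => u.
rewrite !ler_norml => /andP[h1 h2]; have := sqr_ge0 (u - 1); have := sqr_ge0 (u + 1).
move=> p1 p2; apply/andP; split.
  suff : 0 <= (u + 1) ^+ 2 * (2 - u) by nra.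
  by apply: mulr_ge0 => //; lra.
suff : 0 <= (u - 1) ^+ 2 * (2 + u) by nra.
by apply: mulr_ge0 => //; lra.
Qed.

(** Each step multiplies the distance to 1 by (1 - u)(2 + u) / 2 <= 1 - u / 2; the lower bound w <=
    u, carried along, makes the ratio uniform. *)
Lemma iter_sharpen_gt0 n w : 0 < w -> w <= 1 ->
  w <= iter n sharpen w /\ 1 - iter n sharpen w <= (1 - w / 2) ^+ n.
Proof.
move=> w0 w1; elim: n => [|n [IH1 IH2]]; first by rewrite expr0 /=; lra.
have h1 : iter n sharpen w <= 1.
  by apply: le_trans (ler_norm _) _; apply: iter_sharpen_le1; rewrite gtr0_norm.
rewrite iterS exprS; move: (iter n sharpen w) IH1 IH2 h1 => u IH1 IH2 h1.
rewrite /sharpen; split.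
  suff : 0 <= u * (1 - u ^+ 2) by nra.
  by apply: mulr_ge0; nra.
have -> : 1 - (3 * u - u ^+ 3) / 2 = (1 - u) * ((1 - u) * (2 + u) / 2) by field.
apply: (@le_trans _ _ ((1 - u) * (1 - w / 2))).
  by apply: ler_wpM2l; nra.
by rewrite mulrC; apply: ler_wpM2l => //; lra.
Qed.

Lemma iter_sharpenN n w : iter n sharpen (- w) = - iter n sharpen w.
Proof. by elim: n => //= n ->; rewrite /sharpen; field. Qed.

Lemma iter_sharpen_cvg w : `|w| <= 1 -> (fun n => iter n sharpen w) @ \oo --> Num.sg w.
Proof.
have pos v : 0 < v -> v <= 1 -> (fun n => iter n sharpen v) @ \oo --> (1 : F).
  move=> v0 v1; rewrite -[X in _ --> X]subr0.
  have -> : (fun n => iter n sharpen v) = (fun n => 1 - (1 - iter n sharpen v)).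
    by apply/funext => n; rewrite subKr.
  apply: cvgB; first exact: cvg_cst.
  apply: (@squeeze_cvgr _ _ _ _ (fun=> 0) (fun n => (1 - v / 2) ^+ n)).
  - apply: nearW => n; rewrite (proj2 (iter_sharpen_gt0 n v0 v1)) andbT subr_ge0.
    by apply: le_trans (ler_norm _) _; apply: iter_sharpen_le1; rewrite gtr0_norm.
  - exact: cvg_cst.
  - by apply: cvg_expr; rewrite ger0_norm; lra.
rewrite ler_norml => /andP[w1 w2].
case: (ltgtP w 0) => [wn|wp|->].
- rewrite ltr0_sg //; rewrite -[w]opprK; under eq_fun do rewrite iter_sharpenN.
  by apply: cvgN; apply: pos; lra.
- by rewrite gtr0_sg //; exact: pos.
- rewrite sgr0; have -> : (fun n => iter n sharpen 0) = fun=> 0; last exact: cvg_cst.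
  by apply/funext; elim=> //= n ->; rewrite /sharpen; ring.
Qed.

Lemma cis_span_sin (c a : F) : cis_span setT (fun x => (sin (c * (x - a)))%:C).
Proof.
have [b bE] : exists b, c = 2 * pi * b.
  exists (c / (2 * pi)); rewrite mulrC divfK //.
  by rewrite mulf_neq0 ?pnatr_eq0 ?gt_eqF ?pi_gt0.
have h1 := cis_spanZ ((0 +i* (- 2^-1)) * cis (- b * a)) (cis_span_cis (I : setT b)).
have h2 := cis_spanZ ((0 +i* 2^-1) * cis (b * a)) (cis_span_cis (I : setT (- b))).
have := cis_spanD h1 h2; congr cis_span; apply/funext => x.
rewrite -!mulrA -!cisD.
have -> : - b * a + b * x = b * (x - a) by ring.
have -> : b * a + - b * x = - (b * (x - a)) by ring.
rewrite cisN bE /cis -[2 * pi * b * _]mulrA; move: (2 * pi * _) => y; rewrite /expi.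
by apply/eqP; rewrite eq_complex /=; apply/andP; split; apply/eqP; field.
Qed.

Lemma sgr_sin (y : F) : `|y| < pi -> Num.sg (sin y) = Num.sg y.
Proof.
rewrite ltr_norml => /andP[y1 y2]; case: (ltgtP y 0) => [yn|yp|->].
- rewrite (ltr0_sg yn) ltr0_sg // -[y]opprK sinN oppr_lt0.
  by apply: sin_gt0_pi; rewrite oppr_gt0 yn /= ltrNl.
- by rewrite (gtr0_sg yp) gtr0_sg //; apply: sin_gt0_pi; rewrite yp.
- by rewrite sin0.
Qed.

Lemma sgr_le1 (y : F) : `|Num.sg y| <= 1.
Proof. by rewrite normr_sg; case: eqP. Qed.

Lemma cis_span_sharpen n g :
  cis_span setT (fun x => (g x)%:C) -> cis_span setT (fun x => (iter n sharpen (g x))%:C).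
Proof.
move=> hg; elim: n => [|n IH] //.
have h2 := cis_spanM (cis_spanM IH IH) IH.
have := cis_spanD (cis_spanZ (3 / 2)%:C IH) (cis_spanZ (- 2^-1)%:C h2).
congr cis_span; apply/funext => x; rewrite iterS /sharpen; move: (iter n _ _) => u.
by apply/eqP; rewrite eq_complex /=; apply/andP; split; apply/eqP; field.
Qed.

Lemma rapproximable_square_wave (c a : F) : rapproximable (fun x => Num.sg (sin (c * (x - a)))).
Proof.
have s1 (x : F) : `|sin x| <= 1 by rewrite ler_norml sin_geN1 sin_le1.
apply: (rapproximable_bounded (h := fun n x => iter n sharpen (sin (c * (x - a))))).
- by move=> n; apply/cis_span_approximable/cis_span_sharpen/cis_span_sin.
- by move=> n x; exact: iter_sharpen_le1.
- by move=> x; exact: iter_sharpen_cvg.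
Qed.

Lemma near_inv_lt (y : F) (e : F) : 0 < e -> \forall n \near \oo, n.+1%:R^-1 * y < e.
Proof.
move=> e0; have [y0|y0] := lerP y 0.
  by apply: nearW => n; apply: le_lt_trans e0; rewrite mulr_ge0_le0.
near=> n; rewrite mulrC ltr_pdivrMr // mulrC -ltr_pdivrMr //.
apply: (@lt_le_trans _ _ n%:R); last by rewrite ler_nat.
by near: n; exact: nbhs_infty_gtr.
Unshelve. all: by end_near.
Qed.

(** Square waves of growing period: sin((x - a) / (n + 1)) has the sign of x - a as soon as |x - a|
    < pi (n + 1). *)
Lemma rapproximable_sgr (a : F) : rapproximable (fun x => Num.sg (x - a)).
Proof.
apply: (rapproximable_bounded (h := fun n x => Num.sg (sin (n.+1%:R^-1 * (x - a))))).
- by move=> n; exact: rapproximable_square_wave.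
- by move=> n x; exact: sgr_le1.
- move=> x; apply: cvg_near_cst.
  near=> n; rewrite sgr_sin; last first.
    rewrite normrM [X in X * _]gtr0_norm ?invr_gt0 //; near: n.
    by apply: near_inv_lt; exact: pi_gt0.
  by rewrite sgrM [X in X * _]gtr0_sg ?invr_gt0 // mul1r.
Unshelve. all: by end_near.
Qed.

Lemma rapproximableZ (a : F) g : rapproximable g -> rapproximable (fun x => a * g x).
Proof.
move=> /(approximableZ a%:C); congr approximable; apply/funext => x.
by rewrite -rmorphM.
Qed.

Lemma rapproximableD g1 g2 :
  rapproximable g1 -> rapproximable g2 -> rapproximable (fun x => g1 x + g2 x).
Proof.
move=> h1 h2; have := approximableD h1 h2; congr approximable; apply/funext => x.
by rewrite -rmorphD.
Qed.

Lemma rapproximable_cst (a : F) : rapproximable (fun=> a).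
Proof. by apply: cis_span_approximable; exact: cis_span_cst. Qed.

Lemma rapproximable_ray (a : F) : rapproximable (\1_(`]a, +oo[)).
Proof.
(* The thresholds a + 1 / (n + 1) decrease to a, which gives the limit the value -1 at a itself,
   where the sign of x - a is 0. *)
have h : rapproximable (fun x => if a < x then 1 else -1).
  apply: (rapproximable_bounded (h := fun n x => Num.sg (x - (a + n.+1%:R^-1)))).
  - by move=> n; exact: rapproximable_sgr.
  - by move=> n x; exact: sgr_le1.
  - move=> x; apply: cvg_near_cst; have [ax|xa] := ltP a x.
    + near=> n; rewrite gtr0_sg // subr_gt0 -ltrBrDl.
      rewrite -[_^-1]mulr1; near: n; apply: near_inv_lt; lra.
    + near=> n; rewrite ltr0_sg // subr_lt0.
      by apply: le_lt_trans xa _; rewrite ltrDl invr_gt0.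
have := rapproximableZ 2^-1 (rapproximableD h (rapproximable_cst 1)).
congr rapproximable; apply/funext => x.
rewrite indicE mem_setE in_itv /= andbT; case: ifP => _ /=; field.
Unshelve. all: by end_near.
Qed.

(** The sets with approximable indicator form a Dynkin system; it contains the open rays, which are
    stable under intersection and generate the Borel sets. *)
Lemma rapproximable_indic (E : set (measurableTypeR F)) :
  measurable E -> rapproximable (\1_E).
Proof.
pose H := [set A : set F | rapproximable (\1_A)].
have LH : lambda_system setT H.
  split => //.
  - rewrite /H /=; have := rapproximable_cst 1; congr rapproximable.
    by apply/funext => x; rewrite indicE in_setT.
  - move=> A B BA HA HB; rewrite /H /=.
    have := rapproximableD HA (rapproximableZ (-1) HB); congr rapproximable.
    apply/funext => x; rewrite !indicE in_setD.
    have [xB|xB] := boolP (x \in B); last by rewrite andbT mulr0 addr0.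
    have -> : x \in A by rewrite inE; apply: BA; rewrite -inE.
    by rewrite /=; ring.
  - move=> A ndA HA; apply: (rapproximable_bounded (h := fun n => \1_(A n))) => //.
    + by move=> n x; rewrite indicE; case: (x \in A n); rewrite ?normr1 ?normr0.
    + move=> x; apply: cvg_near_cst; rewrite indicE.
      have [|xA] := boolP (x \in \bigcup_n A n).
        rewrite inE => -[m _ xm]; near=> n; rewrite indicE mem_set //.
        have mn : (m <= n)%N by near: n; exact: nbhs_infty_ge.
        by have /subsetPset := ndA _ _ mn; apply.
      apply: nearW => n; rewrite indicE memNset // => xn.
      by move: xA; rewrite notin_setE; apply; exists n.
have GE : <<s (@RGenOInfty.G F) >> `<=` H.
  apply: (lambda_system_subset _ LH) => //; last first.
    by move=> _ [a ->]; exact: rapproximable_ray.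
  move=> _ _ [a ->] [b ->]; exists (Num.max a b).
  by apply/seteqP; split=> x /=; rewrite !in_itv /= !andbT gt_max => /andP.
by move=> mE; apply: GE; move: mE; rewrite RGenOInfty.measurableE.
Unshelve. all: by end_near.
Qed.

Lemma rapproximable_sum (I : Type) (r : seq I) (f : I -> F -> F) :
  (forall i, rapproximable (f i)) -> rapproximable (fun x => \sum_(i <- r) f i x).
Proof.
move=> hf; elim: r => [|i r IH].
  by under eq_fun do rewrite big_nil; exact: rapproximable_cst.
by under eq_fun do rewrite big_cons; exact: rapproximableD.
Qed.

Import HBNNSimple.

Lemma rapproximable_nnsfun (f : {nnsfun measurableTypeR F >-> F}) : rapproximable f.
Proof.
have -> : (f : F -> F) = fun x =>
    \sum_(y <- fset_set (range f)) y * \1_(f @^-1` [set y]) x.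
  by apply/funext => x; rewrite fimfunE fsbig_finite.
apply: rapproximable_sum => y; apply: rapproximableZ; apply: rapproximable_indic.
exact: measurable_sfunP.
Qed.

(** Simple functions 0 <= h_n <= g converge to g, and g^2 dominates (g - h_n)^2. *)
Lemma rapproximable_ge0 g : measurable_fun [set: measurableTypeR F] g ->
  (forall x, 0 <= g x) ->
  mu.-integrable [set: measurableTypeR F] (fun x => (g x ^+ 2)%:E) -> rapproximable g.
Proof.
move=> mg g0 ig.
have mg' : measurable_fun [set: measurableTypeR F] (EFin \o g) by apply/measurable_EFinP.
pose h := nnsfun_approx measurableT mg'.
have hg n x : 0 <= h n x <= g x.
  rewrite fun_ge0 /=.
  by rewrite -lee_fin /h nnsfun_approxE; apply: le_approx => // y _; rewrite lee_fin.
apply: (rapproximable_dominated (h := fun n => h n) (k := fun x => g x ^+ 2)) => //.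
- by move=> n; exact: rapproximable_nnsfun.
- by move=> n x; have /andP[? ?] := hg n x; nra.
- move=> x.
  have := @cvg_nnsfun_approx _ _ _ _ measurableT _ mg' _ x I.
  rewrite -/h => /(_ _)/fine_cvgP[]// y _; by rewrite lee_fin.
Qed.

(** The positive and negative parts of the real and imaginary parts have squares bounded by |f|^2,
    so [rapproximable_ge0] covers each of them. *)
Lemma approximable_L2 (f : F -> F[i]) : L2fun mu f -> approximable mu setT f.
Proof.
move=> /L2funP[mf nf].
have rp g : measurable_fun [set: measurableTypeR F] g ->
    (forall x, g x ^+ 2 <= sqn (f x)) -> rapproximable g.
  move=> mg hg.
  have ig (k : F -> F) : measurable_fun [set: measurableTypeR F] k ->
      (forall x, k x ^+ 2 <= sqn (f x)) ->
      mu.-integrable [set: measurableTypeR F] (fun x => (k x ^+ 2)%:E).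
    move=> mk hk; apply/integrableP; split.
      by apply/measurable_EFinP; exact: measurable_funX.
    apply: le_lt_trans nf; apply: ge0_le_integral => //.
    - by apply: measurableT_comp => //; apply/measurable_EFinP; exact: measurable_funX.
    - by apply/measurable_EFinP; exact: measurable_sqn.
    - by move=> x _; rewrite gee0_abs ?lee_fin ?sqr_ge0.
  have m1 : measurable_fun [set: measurableTypeR F] (fun x => Num.max (g x) 0).
    exact: measurable_maxr.
  have m2 : measurable_fun [set: measurableTypeR F] (fun x => Num.max (- g x) 0).
    by apply: measurable_maxr => //; exact: measurableT_comp.
  have h1 : rapproximable (fun x => Num.max (g x) 0).
    apply: rapproximable_ge0 => //; first by move=> x; rewrite le_max lexx orbT.
    apply: ig => // x; apply: le_trans (hg x).
    by case: (leP (g x) 0) => _ //; rewrite expr0n sqr_ge0.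
  have h2 : rapproximable (fun x => Num.max (- g x) 0).
    apply: rapproximable_ge0 => //; first by move=> x; rewrite le_max lexx orbT.
    apply: ig => // x; apply: le_trans (hg x).
    by case: (leP (- g x) 0) => _ //; rewrite ?sqrrN // expr0n sqr_ge0.
  have := rapproximableD h1 (rapproximableZ (-1) h2); congr rapproximable.
  by apply/funext => x; case: (leP (g x) 0); case: (leP (- g x) 0); lra.
have [m1 m2] := mf.
have h1 : rapproximable (fun x => complex.Re (f x)).
  by apply: rp => // x; rewrite /sqn lerDl sqr_ge0.
have h2 : rapproximable (fun x => complex.Im (f x)).
  by apply: rp => // x; rewrite /sqn lerDr sqr_ge0.
have := approximableD h1 (approximableZ (0 +i* 1) h2); congr approximable.
apply/funext => x; case: (f x) => u v.
by apply/eqP; rewrite eq_complex /=; apply/andP; split; apply/eqP; ring.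
Qed.

End trigonometric_density.

(** * Integration along the maps tau_d and the functional equation of the transform *)

Section self_similarity.
Local Open Scope complex_scope.
Variable F : realType.
Implicit Types (g : F -> F) (M d : F).

Lemma measurable_ifs_map M d :
  measurable_fun [set: measurableTypeR F] (ifs_map M d : measurableTypeR F -> measurableTypeR F).
Proof.
apply: (@measurable_funM _ (measurableTypeR F) F setT (fun=> M^-1) (fun x => x + d)).
  exact: measurable_cst.
apply: measurable_funD; [exact: measurable_id|exact: measurable_cst].
Qed.

Lemma complex_sum (I : Type) (r : seq I) (a b : I -> F) :
  \sum_(i <- r) (a i +i* b i) = (\sum_(i <- r) a i) +i* (\sum_(i <- r) b i).
Proof. by elim: r => [|i r IH]; rewrite ?big_nil // !big_cons IH. Qed.

Variables (mu : probability (measurableTypeR F) F) (M : F) (D : {fset F}).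
Hypothesis mu_ss : self_similar mu M D.

(** Self-similarity says that mu agrees on measurable sets with the average [m] of its images under
    the maps tau_d; integrals against [m] split by scaling, sum and pushforward. *)
Lemma integral_self_similar g : measurable_fun [set: measurableTypeR F] g ->
  (forall x, 0 <= g x) ->
  (\int[mu]_x (g x)%:E =
   (#|` D|%:R^-1)%:E * \sum_(d <- D) \int[mu]_x (g (ifs_map M d x))%:E)%E.
Proof.
move=> mg g0.
have mg' : measurable_fun [set: measurableTypeR F] (EFin \o g) by apply/measurable_EFinP.
have k0 : 0 <= #|` D|%:R^-1 :> F by rewrite invr_ge0.
pose pushm d : {measure set (measurableTypeR F) -> \bar F} :=
  pushforward mu (ifs_map M d : measurableTypeR F -> measurableTypeR F).
pose push := pushm (measurable_ifs_map M).
pose m := mscale (NngNum k0) (msum (fun n => push (nth 0 D n)) (size D)).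
transitivity (\int[m]_x (g x)%:E)%E.
  apply: eq_measure_integral => A mA _; apply: (etrans (mu_ss mA)); rewrite /m /mscale /msum /=.
  by congr (_ * _)%E; rewrite (big_nth 0) big_mkord.
rewrite ge0_integral_mscale //; last by move=> x _; rewrite lee_fin.
congr (_ * _)%E; rewrite ge0_integral_measure_sum //; last by move=> x _; rewrite lee_fin.
rewrite (big_nth 0) big_mkord; apply: eq_bigr => i _.
rewrite ge0_integral_pushforward //.
- exact: measurable_ifs_map.
- by move=> x _; rewrite lee_fin.
Qed.

Lemma bounded_mfun_ifs_map g d : bounded_mfun g -> bounded_mfun (fun x => g (ifs_map M d x)).
Proof.
move=> [mg [B hB]]; split; last by exists B => x.
exact: (measurableT_comp mg (measurable_ifs_map M d)).
Qed.

(** Adding the bound B makes the integrand nonnegative, so [integral_self_similar] applies; B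
    contributes equally to both sides and cancels. *)
Lemma Rintegral_self_similar g : bounded_mfun g -> (0 < #|` D|)%N ->
  (\int[mu]_x g x = #|` D|%:R^-1 * \sum_(d <- D) \int[mu]_x g (ifs_map M d x))%R.
Proof.
move=> bg D0; have [mg [B hB]] := bg.
have i := bounded_mfun_integrable mu.
have bi d := bounded_mfun_ifs_map d bg.
have key h : bounded_mfun h -> (\int[mu]_x (h x + B))%R = (\int[mu]_x h x)%R + B.
  move=> bh; rewrite RintegralD //; [|exact: i|exact/i/bounded_mfun_cst].
  by rewrite Rintegral_cst // (congr1 fine (probability_setT mu)) mulr1.
have bgB := bounded_mfunD bg (bounded_mfun_cst B).
have : (\int[mu]_x (g x + B) =
    #|` D|%:R^-1 * \sum_(d <- D) \int[mu]_x (g (ifs_map M d x) + B))%R.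
  have gB0 x : 0 <= g x + B by have := hB x; rewrite ler_norml => /andP[]; lra.
  have /(congr1 fine) := integral_self_similar (proj1 bgB) gB0.
  rewrite -[LHS]/(\int[mu]_x (g x + B))%R => ->.
  rewrite (eq_bigr (fun d => (\int[mu]_x (g (ifs_map M d x) + B))%R%:E)).
    by rewrite sumEFin.
  move=> d _; rewrite /Rintegral fineK //; apply: integrable_fin_num => //.
  by apply: i; exact: (bounded_mfunD (bi d) (bounded_mfun_cst B)).
rewrite key // (eq_bigr (fun d => (\int[mu]_x g (ifs_map M d x))%R + B)) => [|d _]; last exact: key.
rewrite big_split /= big_const_seq count_predT iter_addr_0 mulrDr.
have -> : #|` D|%:R^-1 * (B *+ size D) = B.
  by rewrite -[B *+ _]mulr_natl mulKf // pnatr_eq0 -lt0n.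
exact: addIr.
Qed.

Lemma cint_self_similar (f : F -> F[i]) : bmeas f -> (0 < #|` D|)%N ->
  cint mu f = #|` D|%:R^-1%:C * \sum_(d <- D) cint mu (fun x => f (ifs_map M d x)).
Proof.
move=> [f1 f2] D0; rewrite complex_sum /cint.
rewrite (Rintegral_self_similar f1) // (Rintegral_self_similar f2) //.
by apply/eqP; rewrite eq_complex /= !mul0r subr0 addr0 !eqxx.
Qed.

(** Composed with tau_d, the exponential of frequency xi becomes that of frequency xi / M times the
    constant [cis (xi / M * d)]. *)
Lemma ft_self_similar (xi : F) : (0 < #|` D|)%N ->
  ft mu xi = #|` D|%:R^-1%:C * (\sum_(d <- D) cis (xi / M * d)) * ft mu (xi / M).
Proof.
move=> D0; rewrite /ft cint_self_similar //; last exact: bmeas_cis.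
rewrite -mulrA mulr_suml; congr (_ * _); apply: eq_bigr => d _.
rewrite -cintZ; last exact: bmeas_cis.
apply: eq_cint => x; rewrite -cisD /ifs_map; congr cis; ring.
Qed.

End self_similarity.

(** * Digit sets, zeros of the mask and the Hadamard property *)

Lemma lowest_digit (I : finType) (N : nat) (e : I -> nat) (delta : I -> int) :
  (1 < N)%N -> injective e -> (forall i, `|delta i| < N%:Z) ->
  (exists i, delta i != 0) ->
  exists i m, \sum_j (N%:Z ^+ e j) * delta j = N%:Z ^+ e i * m /\ ~~ (N %| m)%Z.
Proof.
move=> N1 ie dN [i0 di0].
(* Take a nonzero coefficient of least exponent e i: the other terms are multiples of N^(e i + 1),
   while 0 < |delta i| < N. *)
case: (@arg_minnP _ i0 (fun i => delta i != 0) e di0) => i di imin.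
have H j : exists K : int, j != i -> N%:Z ^+ e j * delta j = N%:Z ^+ e i * (N%:Z * K).
  have [->|dj] := eqVneq (delta j) 0; first by exists 0; rewrite !mulr0.
  have [ji|ji] := eqVneq j i; first by exists 0.
  have eij : (e i < e j)%N.
    rewrite ltn_neqAle imin // andbT; apply: contra ji => /eqP/ie ->; exact: eqxx.
  exists (N%:Z ^+ (e j - (e i).+1) * delta j) => _.
  by rewrite !mulrA -exprSr -exprD subnKC.
have [K hK] := fin_all_exists H.
exists i, (delta i + N%:Z * \sum_(j | j != i) K j); split.
  rewrite (bigD1 i) //= mulrDr; congr (_ + _).
  by rewrite !mulr_sumr; apply: eq_bigr => j ji; rewrite hK.
rewrite rpredDr ?dvdz_mulr //.
apply: contra di; rewrite dvdzE /= => /dvdn_leq hle.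
apply: contraLR (dN i) => d0; rewrite -leNgt.
have := hle; rewrite absz_gt0 d0 => /(_ isT); lia.
Qed.

Lemma PoszX (m n : nat) : Posz (m ^ n) = Posz m ^+ n.
Proof. by elim: n => // n IH; rewrite expnS PoszM IH exprS. Qed.

Section digits.
Local Open Scope complex_scope.
Variable F : realType.
Variables (s R N q : nat) (p : 'I_s -> nat).
Hypotheses (R_gt1 : (1 < R)%N) (N_gt1 : (1 < N)%N).
Hypotheses (p_gt0 : forall i, (0 < p i)%N)
  (p_incr : forall i j : 'I_s, (i < j)%N -> (p i < p j)%N)
  (q_gt0 : (0 < q)%N) (p_ltq : forall i, (p i < q)%N).

Let M := (R * N ^ q)%N.

(* The exponents 0 = p_0 < p_1 < ... < p_s. *)
Definition pexp (i : 'I_s.+1) : nat := if unlift ord0 i is Some j then p j else 0.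

(** One finite type indexes both digit sets: the entry w i multiplies N^(p_i) in D and R N^(q - p_i
    - 1) in L. *)
Definition word_letter := {ffun 'I_s.+1 -> 'I_N}.
Local Notation W := word_letter.
Implicit Types (w v : W) (x y xi : F) (z : int).

Lemma pexp0 : pexp ord0 = 0%N.
Proof. by rewrite /pexp unlift_none. Qed.

Lemma pexp_lift i : pexp (lift ord0 i) = p i.
Proof. by rewrite /pexp liftK. Qed.

Lemma pexp_ltq i : (pexp i < q)%N.
Proof. by case: (unliftP ord0 i) => [j|] ->; rewrite ?pexp_lift ?pexp0. Qed.

Lemma pexp_mono (i j : 'I_s.+1) : (i < j)%N -> (pexp i < pexp j)%N.
Proof.
case: (unliftP ord0 i) (unliftP ord0 j) => [i'|] -> [j'|] ->; rewrite ?pexp_lift ?pexp0 //.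
by rewrite /= /bump /= !add1n ltnS; exact: p_incr.
Qed.

Lemma pexp_inj : injective pexp.
Proof.
move=> i j eij; apply/val_inj/eqP; case: ltngtP => // /pexp_mono; by rewrite eij ltnn.
Qed.

Definition ddigit w : nat := \sum_i N ^ pexp i * w i.
Definition ldigit w : nat := \sum_i R * N ^ (q - (pexp i).+1) * w i.

Let NR_neq0 : N%:R != 0 :> F.
Proof. by rewrite pnatr_eq0; case: N N_gt1. Qed.

Let M_neq0 : M%:R != 0 :> F.
Proof. by rewrite pnatr_eq0 /M muln_eq0 expn_eq0; case: R R_gt1 => //; case: N N_gt1. Qed.

Let R_neq0 : R%:R != 0 :> F.
Proof. by rewrite pnatr_eq0; case: R R_gt1. Qed.

Let M_split i : M%:R = R%:R * N%:R ^+ (q - (pexp i).+1) * N%:R ^+ (pexp i).+1 :> F.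
Proof. by rewrite /M natrM natrX -mulrA -exprD subnK // pexp_ltq. Qed.

Lemma word_diff_bound w v i : `|(w i)%:Z - (v i)%:Z| < N%:Z.
Proof. by have := ltn_ord (w i); have := ltn_ord (v i); lia. Qed.

Lemma word_diff_neq0 w v : w != v -> exists i, (w i)%:Z - (v i)%:Z != 0.
Proof.
move=> wv; apply/existsP; apply: contraNT wv => /existsPn h.
apply/eqP/ffunP => i; have := h i; rewrite negbK subr_eq0 => /eqP [] e.
exact: val_inj.
Qed.

Lemma ddigit_diff w v : w != v -> exists i m,
  (ddigit w)%:Z - (ddigit v)%:Z = N%:Z ^+ pexp i * m /\ ~~ (N %| m)%Z.
Proof.
move=> wv.
have [i [m [e hm]]] := lowest_digit N_gt1 pexp_inj (word_diff_bound w v) (word_diff_neq0 wv).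
exists i, m; split=> //; rewrite -e /ddigit !(big_morph Posz PoszD (erefl _)) -sumrB.
by apply: eq_bigr => j _; rewrite !PoszM mulrBr PoszX.
Qed.

Lemma ldigit_diff w v : w != v -> exists i m,
  (ldigit w)%:Z - (ldigit v)%:Z = R%:Z * N%:Z ^+ (q - (pexp i).+1) * m /\ ~~ (N %| m)%Z.
Proof.
move=> wv.
have ie : injective (fun i => q - (pexp i).+1)%N.
  move=> i j; have := pexp_ltq i; have := pexp_ltq j; move=> h1 h2 h3.
  by apply: pexp_inj; lia.
have [i [m [e hm]]] := lowest_digit N_gt1 ie (word_diff_bound w v) (word_diff_neq0 wv).
exists i, m; split=> //; rewrite -mulrA -e /ldigit !(big_morph Posz PoszD (erefl _)) -sumrB.
by rewrite mulr_sumr; apply: eq_bigr => j _; rewrite !PoszM mulrBr mulrBr PoszX !mulrA.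
Qed.

Lemma ddigit_inj : injective ddigit.
Proof.
move=> w v e; apply/eqP; apply: contraT => /ddigit_diff [i [m [+ hm]]].
rewrite e subrr => /esym/eqP; rewrite mulf_eq0 expf_eq0.
have -> : (N%:Z == 0) = false by lia.
by rewrite andbF /= => /eqP m0; move: hm; rewrite m0 dvdz0.
Qed.

Lemma mem_sumset (A B : {fset F}) x :
  reflect (exists a b, [/\ a \in A, b \in B & x = a + b]) (x \in sumset A B).
Proof.
apply: (iffP idP) => [/imfset2P [a aA [b bB ->]]|[a [b [aA bB ->]]]].
  by exists a, b.
by apply/imfset2P; exists a => //; exists b.
Qed.

Lemma mem_digits (c : F) x : reflect (exists k : 'I_N, x = c * (k : nat)%:R) (x \in digits N c).
Proof.
apply: (iffP idP) => [/imfsetP [k /=]|[k ->]].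
  by rewrite mem_iota add0n => /= kN ->; exists (Ordinal kN).
by apply/imfsetP; exists (k : nat); rewrite //= mem_iota /= add0n.
Qed.

Lemma mem_big_sumset n (c : 'I_n -> F) x :
  reflect (exists k : {ffun 'I_n -> 'I_N}, x = \sum_i c i * (k i : nat)%:R)
    (x \in \big[@sumset F/[fset 0]%fset]_(i < n) digits N (c i)).
Proof.
elim: n c x => [|n IH] c x.
  rewrite big_ord0 inE; apply: (iffP eqP) => [->|[k ->]]; last by rewrite big_ord0.
  have [k] : exists k : {ffun 'I_0 -> 'I_N}, True.
    by exists [ffun=> Ordinal (ltnW N_gt1)].
  by exists k; rewrite big_ord0.
rewrite big_ord_recl; apply: (iffP (mem_sumset _ _ _)).
  move=> [a [b [/mem_digits [k ->] /IH [k' ->] ->]]].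
  exists [ffun i => if unlift ord0 i is Some j then k' j else k].
  rewrite big_ord_recl ffunE unlift_none; congr (_ + _).
  by apply: eq_bigr => i _; rewrite ffunE liftK.
move=> [k ->]; rewrite big_ord_recl.
exists (c ord0 * (k ord0 : nat)%:R), (\sum_(i < n) c (lift ord0 i) * (k (lift ord0 i) : nat)%:R).
split=> //; first by apply/mem_digits; exists (k ord0).
apply/IH; exists [ffun i => k (lift ord0 i)].
by apply: eq_bigr => i _; rewrite ffunE.
Qed.

Lemma mem_Dset x : reflect (exists w, x = (ddigit w)%:R) (x \in Dset F N p).
Proof.
have -> : Dset F N p = \big[@sumset F/[fset 0]%fset]_(i < s.+1) digits N ((N ^ pexp i)%N%:R).
  rewrite big_ord_recl pexp0 expn0; congr sumset.
  by apply: eq_bigr => i _; rewrite pexp_lift.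
have e w : (ddigit w)%:R = \sum_i (N ^ pexp i)%:R * (w i : nat)%:R :> F.
  by rewrite /ddigit natr_sum; apply: eq_bigr => i _; rewrite natrM.
by apply: (iffP (mem_big_sumset _ _)) => -[w ->]; exists w; rewrite e.
Qed.

Lemma mem_Lset x : reflect (exists w, x = (ldigit w)%:R) (x \in Lset F R N q p).
Proof.
pose S := \big[@sumset F/[fset 0]%fset]_(i < s.+1) digits N ((N ^ (pexp i).+1)%N%:R^-1).
have SE : sumset (digits N N%:R^-1)
   (\big[@sumset F/[fset 0]%fset]_(i < s) digits N (N ^ (p i).+1)%N%:R^-1) = S.
  rewrite /S big_ord_recl pexp0 expn1; congr sumset.
  by apply: eq_bigr => i _; rewrite pexp_lift.
have e w : (ldigit w)%:R = (R * N ^ q)%:R * \sum_i (N ^ (pexp i).+1)%:R^-1 * (w i : nat)%:R :> F.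
  rewrite /ldigit natr_sum mulr_sumr; apply: eq_bigr => i _.
  rewrite !natrM !mulrA -!mulrA; congr (_ * _); rewrite mulrA; congr (_ * _).
  by rewrite -{2}(subnK (pexp_ltq i)) expnD natrM mulfK // natrX expf_neq0.
rewrite /Lset SE; apply: (iffP idP) => [/imfsetP [y /= /mem_big_sumset [w ->] ->]|[w ->]].
  by exists w; rewrite e.
apply/imfsetP; exists (\sum_i (N ^ (pexp i).+1)%:R^-1 * (w i : nat)%:R); last exact: e.
by apply/mem_big_sumset; exists w.
Qed.

Lemma big_Dset (f : F -> F[i]) :
  \sum_(d <- Dset F N p) f d = \sum_w f (ddigit w)%:R.
Proof.
rewrite -(big_map (fun w : W => (ddigit w)%:R : F) xpredT f) /=.
apply: perm_big; apply: uniq_perm; first exact: fset_uniq.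
  rewrite map_inj_uniq ?index_enum_uniq // => w v /eqP; rewrite eqr_nat => /eqP.
  exact: ddigit_inj.
move=> x; apply/mem_Dset/mapP => [[w ->]|[w _ ->]]; last by exists w.
by exists w => //; rewrite mem_index_enum.
Qed.

Lemma card_Dset : (#|` Dset F N p| = N ^ s.+1)%N.
Proof.
have : (#|` Dset F N p|%:R : F[i]) = (N ^ s.+1)%:R.
  have := big_Dset (fun=> 1).
  rewrite big_const_seq count_predT iter_addr_0 => ->.
  by rewrite sumr_const card_ffun !card_ord.
by move/eqP; rewrite eqr_nat => /eqP.
Qed.

(** The average of [cis (y * d)] over D ([maskE]), written as a product of geometric sums so that
    its zeros can be read off. *)
Definition mask y : F[i] :=
  \prod_(i < s.+1) (N%:R^-1%:C * \sum_(k < N) cis (k%:R * ((N ^ pexp i)%:R * y))).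

Lemma prod_geom (c : 'I_s.+1 -> F) :
  \prod_i (\sum_(k < N) cis (k%:R * c i)) = \sum_(w : W) cis (\sum_i (w i : nat)%:R * c i).
Proof.
rewrite bigA_distr_bigA /=; apply: eq_bigr => w _.
by rewrite (big_morph (@cis F) (@cisD F) (cis0 F)).
Qed.

Lemma maskE y : mask y = (N ^ s.+1)%:R^-1%:C * \sum_w cis (y * (ddigit w)%:R).
Proof.
rewrite /mask big_split /= prod_geom; congr (_ * _).
  by rewrite prodr_const card_ord -rmorphXn exprVn natrX.
apply: eq_bigr => w _; congr cis; rewrite /ddigit natr_sum mulr_sumr.
by apply: eq_bigr => i _; rewrite natrM; ring.
Qed.

Lemma mask_int (k : int) : mask k%:~R = 1.
Proof.
rewrite /mask big1 // => i _; rewrite [(N ^ pexp i)%:R]pmulrn -intrM geom_cis_int.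
rewrite -(rmorph_nat (real_complex F)) -rmorphM mulVf //.
Qed.

Lemma mask_periodic y (k : int) : mask (y + k%:~R) = mask y.
Proof.
rewrite /mask; apply: eq_bigr => i _; congr (_ * _); apply: eq_bigr => j _.
rewrite mulrDr mulrDr [X in _ + X](_ : _ = (j%:Z * ((N ^ pexp i)%:Z * k))%:~R).
  by rewrite cis_periodic.
by rewrite !intrM.
Qed.

Lemma mask_eq0P y : mask y = 0 -> exists i (k : int),
  (N ^ (pexp i).+1)%:R * y = k%:~R.
Proof.
move=> /eqP; rewrite prodf_seq_eq0 => /hasP [i _ /=].
rewrite mulf_eq0 => /orP[|/eqP].
  by rewrite eq_complex /= eqxx andbT invr_eq0 (negbTE NR_neq0).
move=> /geom_cis_eq0_int [|[k hk] _]; first exact: ltnW.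
by exists i, k; rewrite expnS natrM -mulrA.
Qed.

Lemma not_int_div (m : int) : ~~ (N %| m)%Z ->
  ~ exists j : int, m%:~R / N%:R = j%:~R :> F.
Proof.
move=> Nm [j] /(congr1 ( *%R^~ N%:R)); rewrite divfK // pmulrn -intrM.
by move=> /intr_inj mE; move: Nm; rewrite mE dvdz_mull.
Qed.

(** The factor of index i is a geometric sum with ratio cis(m / N), a nontrivial N-th root of
    unity. *)
Lemma mask_eq0 y i (m : int) : ~~ (N %| m)%Z ->
  y = m%:~R / (N ^ (pexp i).+1)%:R -> mask y = 0.
Proof.
move=> Nm hy; apply/eqP; rewrite prodf_seq_eq0; apply/hasP; exists i.
  by rewrite mem_index_enum.
have e : (N ^ pexp i)%:R * y = m%:~R / N%:R.
  rewrite hy expnS natrM natrX; field.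
  by rewrite NR_neq0 expf_neq0.
apply/eqP; rewrite (_ : \sum_(k < N) _ = 0) ?mulr0 //; apply: (@geom_cis_eq0 _ _ _ m).
  by rewrite e mulrCA mulfV // mulr1.
by rewrite e; exact: not_int_div.
Qed.

Lemma coprimez_ndvd z (m : int) : coprimez z N%:Z -> ~~ (N %| m)%Z -> ~~ (N %| z * m)%Z.
Proof. by move=> cz; rewrite Gauss_dvdzr // coprimez_sym. Qed.

(** By [ldigit_diff] the argument is z m / N^(p_i + 1), where N does not divide z m. *)
Lemma mask_ldigit z w v : coprimez z N%:Z -> w != v ->
  mask (z%:~R * ((ldigit w)%:R - (ldigit v)%:R) / M%:R) = 0.
Proof.
move=> cz /ldigit_diff [i [m [e hm]]].
apply: (@mask_eq0 _ i (z * m)); first exact: coprimez_ndvd.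
rewrite (_ : _ - _ = ((ldigit w)%:Z - (ldigit v)%:Z)%:~R); last by rewrite intrB.
rewrite e (M_split i) !intrM rmorphXn /= natrX; field.
by rewrite ?R_neq0 !expf_neq0.
Qed.

(** Orthogonality for two elements of D: the sum over w is a constant times a product of geometric
    sums, one for each entry of w, and the factor of the index i given by [ddigit_diff] has ratio
    cis(z m / N). *)
Lemma sum_cis_ldigit z xi u v : coprimez z N%:Z -> u != v ->
  \sum_w cis ((xi + z%:~R * (ldigit w)%:R) / M%:R * ((ddigit u)%:R - (ddigit v)%:R)) = 0.
Proof.
move=> cz /ddigit_diff [i [m [e hm]]].
set D : F := _ - _.
have DE : D = (N ^ pexp i)%:R * m%:~R.
  rewrite /D (_ : _ - _ = ((ddigit u)%:Z - (ddigit v)%:Z)%:~R); last by rewrite intrB.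
  by rewrite e intrM rmorphXn /= natrX.
pose c (j : 'I_s.+1) : F := z%:~R * D / (N ^ (pexp j).+1)%:R.
transitivity (\sum_w cis (xi / M%:R * D) * cis (\sum_j ((w : W) j : nat)%:R * c j)).
  apply: eq_bigr => w _; rewrite -cisD; congr cis.
  rewrite mulrDl mulrDl; congr (_ + _).
  rewrite /ldigit natr_sum mulr_sumr !mulr_suml; apply: eq_bigr => j _.
  rewrite (M_split j) /c !natrM !natrX; field.
  by rewrite ?R_neq0 !expf_neq0.
rewrite -mulr_sumr -prod_geom (_ : \prod_j _ = 0) ?mulr0 //.
apply/eqP; rewrite prodf_seq_eq0; apply/hasP; exists i; first by rewrite mem_index_enum.
apply/eqP.
have ci : c i = (z * m)%:~R / N%:R.
  rewrite /c DE expnS !natrM intrM natrX; field.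
  by rewrite NR_neq0 expf_neq0.
apply: (@geom_cis_eq0 _ _ _ (z * m)); first by rewrite ci mulrCA mulfV // mulr1.
by rewrite ci; apply: not_int_div; exact: coprimez_ndvd.
Qed.

(** Expanding the squared modulus gives a double sum over u and v in which [sum_cis_ldigit] leaves
    only the diagonal: N^(s+1) terms equal to N^(s+1), against the normalization N^(-2(s+1)). *)
Lemma mask_hadamard z xi : coprimez z N%:Z ->
  \sum_w sqn (mask ((xi + z%:~R * (ldigit w)%:R) / M%:R)) = 1.
Proof.
move=> cz; apply: (@complexI F); rewrite real_complex_sum.
pose y w := (xi + z%:~R * (ldigit w)%:R) / M%:R.
set k : F[i] := (N ^ s.+1)%:R^-1%:C.
transitivity (\sum_w k * k * \sum_u \sum_v cis (y w * ((ddigit u)%:R - (ddigit v)%:R))).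
  apply: eq_bigr => w _; rewrite sqnE maskE -/(y w) conjcM conjc_sum -/k.
  have -> : conjc k = k by exact: conjc_real.
  rewrite mulrACA; congr (_ * _); rewrite mulr_suml; apply: eq_bigr => u _.
  by rewrite mulr_sumr; apply: eq_bigr => v _; rewrite -cisN -cisD mulrBr.
rewrite -mulr_sumr exchange_big /=.
transitivity (k * k * \sum_(u : W) (N ^ s.+1)%:R).
  congr (_ * _); apply: eq_bigr => u _; rewrite exchange_big /= (bigD1 u) //=.
  rewrite [X in _ + X]big1 => [|v vu]; last by apply: sum_cis_ldigit; rewrite // eq_sym.
  rewrite addr0 (eq_bigr (fun=> 1)) => [|w _]; last by rewrite subrr mulr0 cis0.
  by rewrite sumr_const card_ffun !card_ord.
rewrite sumr_const card_ffun !card_ord -[_ *+ _]mulr_natr mulrACA.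
have -> : k * (N ^ s.+1)%:R = 1.
  rewrite /k -(rmorph_nat (real_complex F)) -rmorphM mulVf //.
  by rewrite natrX expf_neq0.
by rewrite mulr1.
Qed.

End digits.

(** * Values of words in base M *)

Section words.
Variables (W : Type) (l : W -> nat) (M : nat).
Implicit Types u v : seq W.

(** The head of a word is its lowest digit, so appending zero letters at the end changes the length
    but not the value. *)
Definition wval u : nat := foldr (fun w n => l w + M * n)%N 0%N u.

Lemma wval_cat u v : wval (u ++ v) = (wval u + M ^ size u * wval v)%N.
Proof.
elim: u => [|w u IH] /=; first by rewrite expn0 mul1n.
by rewrite IH expnS mulnDr addnA mulnA.
Qed.

Lemma wval_nseq w n : l w = 0%N -> wval (nseq n w) = 0%N.
Proof. by move=> l0; elim: n => //= n ->; rewrite l0 muln0. Qed.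

End words.

Lemma cvg_fsum (F : realType) (T I : Type) (G : set_system T) (FG : Filter G)
    (r : seq I) (f : I -> T -> F) (a : I -> F) :
  (forall i, f i x @[x --> G] --> a i) ->
  \sum_(i <- r) f i x @[x --> G] --> \sum_(i <- r) a i.
Proof.
move=> h; elim: r => [|i r IH].
  by under eq_fun do rewrite big_nil; rewrite big_nil; exact: cvg_cst.
by under eq_fun do rewrite big_cons; rewrite big_cons; exact: cvgD.
Qed.

(** * Continuity of the Fourier transform *)

Section fourier_transform.
Local Open Scope complex_scope.
Variable F : realType.
Variable mu : probability (measurableTypeR F) F.

Lemma ftN (xi : F) : ft mu (- xi) = conjc (ft mu xi).
Proof.
rewrite /ft -cint_conj; last exact: bmeas_cis.
by apply: eq_cint => x; rewrite mulNr cisN.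
Qed.

Lemma mulrr_continuous (a b : F) : continuous (fun x : F => a * (b * x)).
Proof.
have -> : (fun x : F => a * (b * x)) = *%R (a * b) by apply/funext => x; rewrite mulrA.
exact: mulrl_continuous.
Qed.

Lemma continuous_int (g : F -> F) : continuous g -> (forall x, `|g x| <= 1) ->
  continuous (fun xi : F => \int[mu]_x g (2 * pi * (xi * x)))%R.
Proof.
move=> cg bg xi.
have mg (c : F) : measurable_fun [set: measurableTypeR F] (fun x => g (2 * pi * (c * x))).
  apply: continuous_measurable_fun => x.
  apply: (@continuous_comp _ _ _ (fun x : F => 2 * pi * (c * x)) g); last exact: cg.
  exact: mulrr_continuous.
have := @continuity_under_integral F _ _ mu (fun xi x => g (2 * pi * (xi * x)))
   setT measurableT (xi - 1) (xi + 1).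
move=> /(_ _ _ (fun=> 1)) H; apply: H.
- move=> c _; apply: bounded_mfun_integrable; split; first exact: mg.
  by exists 1.
- apply: aeW => x _ c _.
  apply: (@continuous_comp _ _ _ (fun c : F => 2 * pi * (c * x)) g); last exact: cg.
  have -> : (fun c : F => 2 * pi * (c * x)) = fun c => 2 * pi * (x * c).
    by apply/funext => ?; rewrite [x * _]mulrC.
  exact: mulrr_continuous.
- by apply: bounded_mfun_integrable; exact: bounded_mfun_cst.
- by move=> c _; apply: aeW => x _.
- by rewrite inE /= in_itv /=; lra.
Qed.

Lemma continuous_sqn_ft : continuous (fun xi : F => sqn (ft mu xi)).
Proof.
move=> xi; have c1 := @continuous_int cos (@continuous_cos F).
have c2 := @continuous_int sin (@continuous_sin F).
have {}c1 := c1 (fun x => _) xi.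
have {}c2 := c2 (fun x => _) xi.
rewrite /sqn; apply: cvgD; rewrite expr2; under eq_fun do rewrite expr2.
  by apply: cvgM; apply: c1 => x; rewrite ler_norml cos_geN1 cos_le1.
by apply: cvgM; apply: c2 => x; rewrite ler_norml sin_geN1 sin_le1.
Qed.

End fourier_transform.

(** Take the least return time d over all starting points; a repetition at a < b < d would give the
    shorter return time b - a. *)
Lemma minimal_cycle (T : Type) (x : nat -> T) :
  (exists i j, (i < j)%N /\ x i = x j) ->
  exists i d, [/\ (0 < d)%N, x i = x (i + d)%N &
    forall a b, (a < d)%N -> (b < d)%N -> x (i + a)%N = x (i + b)%N -> a = b].
Proof.
move=> [i0 [j0 [ij0 xij0]]].
have ex : exists d, (0 < d)%N && `[< exists i, x i = x (i + d)%N >].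
  exists (j0 - i0)%N; rewrite subn_gt0 ij0; apply/asboolP; exists i0.
  by rewrite subnKC // ltnW.
case: (ex_minnP ex) => d /andP[d0 /asboolP [i xi_d]] dmin; exists i, d; split=> // a b.
wlog ab : a b / (a <= b)%N => [hw ad bd e|ad bd e].
  have [ab|/ltnW ba] := leqP a b; first exact: hw.
  by apply/esym; apply: hw.
move: ab; rewrite leq_eqVlt => /orP[/eqP //|ab].
have db : (d <= b - a)%N.
  apply: dmin; rewrite subn_gt0 ab; apply/asboolP; exists (i + a)%N.
  by rewrite -addnA subnKC // ltnW.
by move: (leq_ltn_trans (leq_subr a b) bd); rewrite ltnNge db.
Qed.

(** * Completeness of the exponential system of a Hadamard pair *)

Section hadamard_system.
Local Open Scope complex_scope.
Variable F : realType.
Variable mu : probability (measurableTypeR F) F.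
Variables (W : finType) (l : W -> nat) (w0 : W) (M : nat) (m : F -> F[i]) (z : int).
Hypothesis M_gt1 : (1 < M)%N.
Hypothesis l_w0 : l w0 = 0%N.
Hypothesis m_periodic : forall y (k : int), m (y + k%:~R) = m y.
Hypothesis m_eq0 : forall y, m y = 0 -> exists k : int, M%:R * y = k%:~R.
Hypothesis ft_mask : forall xi, ft mu xi = m (xi / M%:R) * ft mu (xi / M%:R).
Hypothesis m_orthogonal : forall w v : W, w != v ->
  m (z%:~R * ((l w)%:R - (l v)%:R) / M%:R) = 0.
Hypothesis m_hadamard : forall xi,
  \sum_w sqn (m ((xi + z%:~R * (l w)%:R) / M%:R)) = 1.

Local Notation val := (wval l M).
Implicit Types (xi : F) (w : W) (u v : seq W).

Let M_neq0 : M%:R != 0 :> F.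
Proof. by rewrite pnatr_eq0; case: M M_gt1. Qed.

Lemma ft_zoom_cvg xi : (fun n => sqn (ft mu (xi / M%:R ^+ n))) @ \oo --> (1 : F).
Proof.
have c0 : (fun n => xi / M%:R ^+ n) @ \oo --> (0 : F).
  rewrite -(mulr0 xi); apply: cvgM; first exact: cvg_cst.
  under eq_fun do rewrite -exprVn; apply: cvg_expr.
  rewrite normfV ger0_norm // invf_lt1; first by rewrite ltr1n.
  by rewrite ltr0n; case: M M_gt1.
have := cvg_comp _ _ c0 (@continuous_sqn_ft _ mu 0).
by rewrite /= ft0 sqn1.
Qed.

(** If no mask factor vanished, the zero would pass to every xi / M^n, where the transform tends to
    1. *)
Lemma ft_eq0 xi : ft mu xi = 0 -> exists j, m (xi / M%:R ^+ j.+1) = 0.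
Proof.
move=> f0; apply: contrapT => /forallNP h.
have fn n : ft mu (xi / M%:R ^+ n) = 0.
  elim: n => [|n]; first by rewrite expr0 divr1.
  rewrite ft_mask => /eqP; rewrite mulf_eq0.
  have -> : xi / M%:R ^+ n / M%:R = xi / M%:R ^+ n.+1 by rewrite exprS invfM mulrA mulrAC.
  by move=> /orP[/eqP/h|/eqP].
have := @ft_zoom_cvg xi; under eq_fun do rewrite fn sqn0.
move=> h1; have /eqP : (0 : F) = 1 by apply: (cvg_unique _ _ h1) => //; exact: cvg_cst.
by rewrite eq_sym oner_eq0.
Qed.

(** Each use of [ft_mask] removes a pair of equal first letters. At the first difference the mask
    vanishes, the higher digits being an integer shift. The term in y allows congruences modulo M^n,
    as needed for periodic words. *)
Lemma ft_words u v (y : int) : size u = size v -> u <> v ->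
  ft mu (z%:~R * ((val u)%:R - (val v)%:R) + M%:R ^+ size u * y%:~R) = 0.
Proof.
elim: u v y => [|w u IH] [|w' v] y //= [suv] uv.
rewrite ft_mask.
have e :
    (z%:~R * ((l w + M * val u)%:R - (l w' + M * val v)%:R) + M%:R ^+ (size u).+1 * y%:~R) / M%:R =
   z%:~R * ((l w)%:R - (l w')%:R) / M%:R +
   (z%:~R * ((val u)%:R - (val v)%:R) + M%:R ^+ size u * y%:~R) :> F.
  by rewrite !natrD !natrM exprS; field.
have [ww'|ww'] := eqVneq w w'.
  rewrite e ww' subrr mulr0 mul0r add0r IH ?mulr0 // => uv'.
  by apply: uv; rewrite ww' uv'.
rewrite e.
have -> : z%:~R * ((val u)%:R - (val v)%:R) + M%:R ^+ size u * y%:~R =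
   (z * ((val u)%:Z - (val v)%:Z) + M%:Z ^+ size u * y)%:~R :> F.
  by rewrite intrD !intrM intrB rmorphXn.
by rewrite m_periodic m_orthogonal // mul0r.
Qed.

(* The square norm of the projection of the exponential of frequency - xi onto the span
   of those of frequencies z val u, for u of length n. *)
Definition Qn n xi : F := \sum_(u : n.-tuple W) sqn (ft mu (xi + z%:~R * (val u)%:R)).

Lemma n2_projection_words n xi :
  n2 mu (fun x => cis (xi * x) -
     \sum_(u : n.-tuple W) ft mu (xi - z%:~R * (val u)%:R) * cis (z%:~R * (val u)%:R * x)) =
  (1 - Qn n (- xi))%:E.
Proof.
rewrite n2_projection.
  congr (_ - _)%:E; apply: eq_bigr => u _.
  by rewrite -[LHS]sqn_conj -ftN opprB addrC.
move=> u v uv; have := @ft_words u v 0.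
rewrite !size_tuple mulr0 addr0 mulrBr; apply=> //.
by move/val_inj => e; move: uv; rewrite e eqxx.
Qed.

Lemma Qn_le1 n xi : Qn n xi <= 1.
Proof.
have := n2_ge0 mu (fun x => cis (- xi * x) -
     \sum_(u : n.-tuple W) ft mu (- xi - z%:~R * (val u)%:R) * cis (z%:~R * (val u)%:R * x)).
by rewrite n2_projection_words opprK lee_fin subr_ge0.
Qed.

Lemma Qn_ge0 n xi : 0 <= Qn n xi.
Proof. by apply: sumr_ge0 => u _; exact: sqn_ge0. Qed.

Definition succ xi w : F := (xi + z%:~R * (l w)%:R) / M%:R.

Lemma Qn0 xi : Qn 0 xi = sqn (ft mu xi).
Proof.
rewrite /Qn (bigD1 [tuple]) //= mulr0 addr0 big1 ?addr0 // => u.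
by rewrite [u]tuple0 => /eqP.
Qed.

(** The first letter of a word selects the branch [succ xi w]; the remaining letters shift the
    argument of the mask by an integer, so its value does not depend on them. *)
Lemma QnS n xi : Qn n.+1 xi = \sum_w sqn (m (succ xi w)) * Qn n (succ xi w).
Proof.
rewrite /Qn (reindex (fun wu : W * n.-tuple W => [tuple of wu.1 :: wu.2])) /=; last first.
  exists (fun t => (thead t, [tuple of behead t])) => [[w u] _|t _] /=.
    by congr pair; apply/val_inj.
  by rewrite -tuple_eta.
rewrite -(pair_bigA _ (fun w (u : n.-tuple W) =>
   sqn (ft mu (xi + z%:~R * (l w + M * val u)%:R)))) /=.
apply: eq_bigr => w _; rewrite mulr_sumr; apply: eq_bigr => u _.
rewrite ft_mask -sqnM; congr (sqn (_ * ft mu _)).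
  rewrite -(m_periodic (succ xi w) (z * (val u)%:Z)); congr m.
  by rewrite /succ intrM natrD natrM; field.
by rewrite /succ natrD natrM; field.
Qed.

(** The zero letter alone gives Q_0 <= Q_1, by [ft_mask]; positivity of the transfer operator
    propagates the inequality. *)
Lemma Qn_incr n xi : Qn n xi <= Qn n.+1 xi.
Proof.
elim: n xi => [|n IH] xi.
  rewrite QnS Qn0 (bigD1 w0) //= Qn0 -sqnM /succ l_w0 mulr0 addr0 -ft_mask lerDl.
  by apply: sumr_ge0 => w _; rewrite mulr_ge0 ?sqn_ge0 ?Qn_ge0.
rewrite !(QnS _ xi); apply: ler_sum => w _.
by apply: ler_wpM2l; [exact: sqn_ge0|exact: IH].
Qed.

Lemma Qn_nondecreasing xi : nondecreasing_seq (Qn ^~ xi).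
Proof. by apply/nondecreasing_seqP => n; exact: Qn_incr. Qed.

Lemma continuous_Qn n : continuous (Qn n).
Proof.
move=> xi; apply: cvg_fsum => u.
apply: (@continuous_comp _ _ _ (fun xi : F => xi + z%:~R * (val u)%:R) (fun xi => sqn (ft mu xi))).
  apply: cvgD; [exact: cvg_id|exact: cvg_cst].
exact: continuous_sqn_ft.
Qed.


Definition Qlim xi : F := limn (Qn ^~ xi).

Lemma Qn_cvg xi : Qn ^~ xi @ \oo --> Qlim xi.
Proof.
apply: nondecreasing_is_cvgn; first exact: Qn_nondecreasing.
by exists 1 => _ [n _ <-]; exact: Qn_le1.
Qed.

Lemma Qn_le_Qlim n xi : Qn n xi <= Qlim xi.
Proof.
apply: nondecreasing_cvgn_le; first exact: Qn_nondecreasing.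
by apply/cvg_ex; exists (Qlim xi); exact: Qn_cvg.
Qed.

Lemma Qlim_le1 xi : Qlim xi <= 1.
Proof.
apply: limr_le; first by apply/cvg_ex; exists (Qlim xi); exact: Qn_cvg.
by apply: nearW => n; exact: Qn_le1.
Qed.

Lemma QlimE xi : Qlim xi = \sum_w sqn (m (succ xi w)) * Qlim (succ xi w).
Proof.
have c1 : Qn n.+1 xi @[n --> \oo] --> Qlim xi by rewrite (cvg_shiftS (Qn ^~ xi)); exact: Qn_cvg.
apply: (cvg_unique _ c1) => //.
have -> : (fun n => Qn n.+1 xi) = fun n => \sum_w sqn (m (succ xi w)) * Qn n (succ xi w).
  by apply/funext => n; rewrite QnS.
apply: cvg_fsum => w; apply: cvgM; [exact: cvg_cst|exact: Qn_cvg].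
Qed.

#[local] Opaque Qlim.

Section minimizer.
Variable r : F.
Hypothesis r_ge : forall w, `|z%:~R * (l w)%:R| <= r.

(** The interval [-r, r] is stable since (r + r) / M <= r for M >= 2. *)
Lemma succ_bound xi w : `|xi| <= r -> `|succ xi w| <= r.
Proof.
move=> hx; have M2 : 2 <= M%:R :> F by rewrite ler_nat.
rewrite /succ normrM normfV [X in _ / X]ger0_norm // ler_pdivrMr; last lra.
have := ler_normD xi (z%:~R * (l w)%:R); have := r_ge w; have := normr_ge0 xi.
move: hx; nra.
Qed.

Definition minimizer xi := `|xi| <= r /\ forall y, `|y| <= r -> Qlim xi <= Qlim y.

(** As a supremum of continuous functions, Q is lower semicontinuous; a cluster point of a
    minimizing sequence is a minimizer. *)
Lemma minimizer_exists : exists xi, minimizer xi.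
Proof.
have r0 : 0 <= r by apply: le_trans (r_ge w0).
pose A := [set Qlim y | y in [set y | `|y| <= r]].
have hA : has_inf A.
  split; first by exists (Qlim 0), 0; rewrite //= normr0.
  by exists 0 => _ [y _ <-]; apply: le_trans (Qn_ge0 0 y) (Qn_le_Qlim 0 y).
have /choice [x hx] : forall n : nat, exists y, `|y| <= r /\ Qlim y < inf A + n.+1%:R^-1.
  move=> n; have e0 : 0 < n.+1%:R^-1 :> F by rewrite invr_gt0.
  by have [_ [y yr <-] hy] := inf_adherent e0 hA; exists y.
have [c [cr hc]] : `[(- r), r]%classic `&` cluster (x @ \oo) !=set0.
  apply: segment_compact; exists 0%N => // n _ /=.
  by rewrite in_itv /= -ler_norml; exact: (hx n).1.
have {}cr : `|c| <= r by move: cr; rewrite /= in_itv /= -ler_norml.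
exists c; split=> // y yr; apply: (@le_trans _ _ (inf A)); last first.
  by apply: inf_lbound; [exact: hA.2|exists y].
apply: limr_le; first by apply/cvg_ex; exists (Qlim c); exact: Qn_cvg.
apply: nearW => n; rewrite leNgt; apply/negP => qn.
(* Half the supposed gap: near c, Q >= Q_n > inf A + eps, while Q falls below this bound far along
   the sequence x. *)
pose eps := (Qn n c - inf A) / 2.
have e0 : 0 < eps by rewrite /eps; lra.
have [_ [[k hk <-] hq]] : [set x k | k in [set k | k.+1%:R^-1 < eps]] `&`
    [set y | inf A + eps < Qn n y] !=set0.
  apply: hc.
    have [k0 _ hk0] := near_inv_lt 1 e0.
    by exists k0 => // k /hk0; rewrite mulr1 /= => hk; exists k.
  apply: (cvgr_gt _ (@continuous_Qn n c)); rewrite /eps; lra.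
have := (hx k).2; have := Qn_le_Qlim n (x k); move: hk hq => /=.
move: {e0} eps (k.+1%:R^-1) (Qn n _) (Qlim _) => e a b d; lra.
Qed.

(** By [QlimE] and [m_hadamard], the minimum is an average of values at least as large; those of
    positive weight must equal it. *)
Lemma minimizer_succ xi w : minimizer xi -> m (succ xi w) != 0 ->
  minimizer (succ xi w) /\ Qlim (succ xi w) = Qlim xi.
Proof.
move=> [xr xm] mw.
suff e : Qlim (succ xi w) = Qlim xi.
  by split=> //; split; [exact: succ_bound|rewrite e].
have H : \sum_w sqn (m (succ xi w)) * (Qlim (succ xi w) - Qlim xi) = 0.
  under eq_bigr do rewrite mulrBr.
  by rewrite sumrB -QlimE -mulr_suml m_hadamard mul1r subrr.
have nn (v : W) : true -> 0 <= sqn (m (succ xi v)) * (Qlim (succ xi v) - Qlim xi).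
  by move=> _; rewrite mulr_ge0 ?sqn_ge0 // subr_ge0; apply: xm; exact: succ_bound.
have /eqP : sqn (m (succ xi w)) * (Qlim (succ xi w) - Qlim xi) = 0.
  exact: (psumr_eq0P nn H).
by rewrite mulf_eq0 sqn_eq0 (negbTE mw) /= subr_eq0 => /eqP.
Qed.

Lemma minimizer_eq xi y : minimizer xi -> minimizer y -> Qlim xi = Qlim y.
Proof. by move=> [xr xm] [yr ym]; apply/eqP; rewrite eq_le xm // ym. Qed.

(* The zeros of the mask are in M^-1 Z, so a non-integer minimizer xi drags along all the
   xi / M^n, where the transform tends to 1. *)
Lemma minimizer_nonint xi : minimizer xi -> ~ (exists k : int, xi = k%:~R) -> 1 <= Qlim xi.
Proof.
move=> mx nk.
have orb n : minimizer (xi / M%:R ^+ n) /\ Qlim (xi / M%:R ^+ n) = Qlim xi.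
  elim: n => [|n [IH1 IH2]]; first by rewrite expr0 divr1.
  have e : xi / M%:R ^+ n.+1 = succ (xi / M%:R ^+ n) w0.
    by rewrite /succ l_w0 mulr0 addr0 exprS invfM mulrCA mulrC.
  rewrite e -IH2; apply: minimizer_succ => //; rewrite -e.
  apply/eqP => /m_eq0 [k hk]; apply: nk; exists (M%:Z ^+ n * k).
  have eM : (M%:Z ^+ n)%:~R = M%:R ^+ n :> F by rewrite rmorphXn.
  by rewrite intrM eM -hk (mulrA (_ ^+ n)) -exprSr [RHS]mulrC divfK // expf_neq0.
have cv := @ft_zoom_cvg xi.
rewrite -(cvg_lim _ cv) //; apply: limr_le; first by apply/cvg_ex; exists 1.
apply: nearW => n; rewrite -Qn0 -(orb n).2; exact: Qn_le_Qlim.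
Qed.

End minimizer.

(** The condition on words in dynamical form: x is an integer cycle of [succ] with distinct points,
    and u is its word. [no_cycle_ss] derives it from divisibility. *)
Hypothesis no_cycle : forall (n : nat) (x : nat -> int) (u : nat -> W), (0 < n)%N ->
  (forall k, M%:Z * x k.+1 = x k + z * (l (u k))%:Z) -> x n = x 0%N ->
  (forall i j, (i < n)%N -> (j < n)%N -> x i = x j -> i = j) -> x 0%N = 0.

Lemma int_pigeonhole (x : nat -> int) (B : nat) : (forall n, `|x n| <= B%:Z) ->
  exists i j, (i < j)%N /\ x i = x j.
Proof.
move=> hB.
(* Adding B maps [-B, B] into the 2B + 1 numbers 0, ..., 2B, so 2B + 2 indices force a collision. *)
pose f (k : 'I_(B.*2.+2)) : 'I_(B.*2.+1) := inord (absz (x k + B%:Z)%R).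
have /injectivePn [i [j ij fij]] : ~~ injectiveb f.
  by apply/negP => /injectiveP /leq_card; rewrite !card_ord ltnn.
have xij : x i = x j.
  have bx k : (absz (x k + B%:Z)%R < B.*2.+1)%N by have := hB k; lia.
  move/(congr1 (@nat_of_ord _)): fij; rewrite /f /= !inordK //.
  by have := hB i; have := hB j; lia.
have [h|h|/val_inj h] := ltngtP i j.
- by exists i, j.
- by exists j, i.
- by rewrite h eqxx in ij.
Qed.

Lemma Qlim_eq1 xi : Qlim xi = 1.
Proof.
apply/eqP; rewrite eq_le Qlim_le1 /=.
(* This r bounds |xi| and every |z l_w|, so [-r, r] contains xi and is stable. *)
pose r : F := `|xi| + \sum_w `|z%:~R * (l w)%:R|.
have hr w : `|z%:~R * (l w)%:R| <= r.
  rewrite /r (bigD1 w) //= addrCA lerDl addr_ge0 // sumr_ge0 //.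
have xr : `|xi| <= r by rewrite lerDl sumr_ge0.
have [x0 m0] := minimizer_exists hr.
suff : 1 <= Qlim x0 by move=> h; apply: le_trans h _; apply: m0.2.
rewrite leNgt; apply/negP => lt1.
have mint y : minimizer r y -> exists k : int, y = k%:~R.
  move=> my; apply: contrapT => nk.
  have := minimizer_nonint hr my nk.
  by rewrite -(minimizer_eq m0 my) leNgt lt1.
have step (k : int) : exists g : W * int, minimizer r k%:~R ->
    minimizer r g.2%:~R /\ M%:Z * g.2 = k + z * (l g.1)%:Z.
  (* Nothing is asked of the image of a non-minimizer, and [(w0, 0)] is a dummy value. *)
  have [mk|] := pselect (minimizer r (k%:~R : F)); last by exists (w0, 0).
  have [w mw] : exists w, m (succ k%:~R w) != 0.
    apply: contrapT => /forallNP h; have := m_hadamard k%:~R.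
    rewrite big1; first by move/eqP; rewrite eq_sym oner_eq0.
    by move=> w _; have /negP := h w; rewrite negbK => /eqP ->; rewrite sqn0.
  have [ms _] := minimizer_succ hr mk mw.
  have [k' e] := mint _ ms.
  exists (w, k') => _; split; first by rewrite -e.
  apply: (@intr_inj F); rewrite intrM intrD intrM /= -e /succ.
  by rewrite [LHS]mulrC divfK.
have [g hg] := choice step.
have [k0 hk0] := mint _ m0.
pose x n := iter n (fun k => (g k).2) k0.
have mx n : minimizer r (x n)%:~R.
  elim: n => [|n IH]; first by rewrite /= -hk0.
  exact: (hg _ IH).1.
have rec n : M%:Z * x n.+1 = x n + z * (l (g (x n)).1)%:Z by exact: (hg _ (mx n)).2.
have xB n : `|x n| <= (Num.bound r)%:Z.
  have /ltW := archi_boundP (le_trans (normr_ge0 _) xr).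
  move/(le_trans (mx n).1); rewrite -intr_norm.
  by rewrite [_%:R]pmulrn ler_int.
(* The integer orbit is bounded, hence repeats, and a shortest return gives a cycle with distinct
   points. *)
have [i [d [d0 xi_d dinj]]] := minimal_cycle (int_pigeonhole xB).
have xi0 : x (i + 0)%N = 0.
  apply: (@no_cycle d (fun k => x (i + k)%N) (fun k => (g (x (i + k)%N)).1)) => //.
  - by move=> k; rewrite addnS; exact: rec.
  - by rewrite addn0 -xi_d.
have := mx i; rewrite -(addn0 i) xi0 => m00.
(* Thus 0 is a minimizer, where Q(0) >= Q_0(0) = |ft(0)|^2 = 1. *)
have := Qn_le_Qlim 0 0; rewrite Qn0 ft0 sqn1 -(minimizer_eq m0 m00).
by rewrite leNgt lt1.
Qed.

(** The squared distance to the span of the words of length n is at most 1 - Q_n(-xi), which tends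
    to 0 by [Qlim_eq1]. *)
Lemma approximable_cis_words (G : set F) xi :
  (forall u, G (z%:~R * (val u)%:R)) -> approximable mu G (fun x => cis (xi * x)).
Proof.
move=> hG; split; first exact/bmeas_cmeas/bmeas_cis.
move=> eps e0.
have h1 : 1 - eps < Qlim (- xi) by rewrite Qlim_eq1; lra.
have [n _ /(_ n (leqnn n)) /= hn] := cvgr_gt _ (@Qn_cvg (- xi)) _ h1.
exists (fun x => \sum_(u : n.-tuple W) ft mu (xi - z%:~R * (val u)%:R) *
     cis (z%:~R * (val u)%:R * x)); last first.
  by rewrite n2_projection_words lte_fin; lra.
exists [seq (ft mu (xi - z%:~R * (val u)%:R), z%:~R * (val u)%:R) |
   u : n.-tuple W <- index_enum _]; split; first by move=> c /mapP [u _ ->]; exact: hG.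
by apply/funext => x; rewrite big_map.
Qed.

End hadamard_system.

(** * Criteria for spectra and for points of the attractor *)

Section spectral_tools.
Local Open Scope complex_scope.
Variable F : realType.
Variable mu : probability (measurableTypeR F) F.
Implicit Types (G : set F) (x : F).

Lemma L2fun_cis x : L2fun mu (fun y => expi (2 * pi * x * y)).
Proof.
have -> : (fun y : F => expi (2 * pi * x * y)) = fun y => cis (x * y).
  by apply/funext => y; rewrite /cis mulrA.
apply/L2funP; split; first exact/bmeas_cmeas/bmeas_cis.
by rewrite n2E ?ltry //; exact: bmeas_cis.
Qed.

(** Such an exponential has distance at least 1 from every combination over G, by [n2_orthogonal],
    against density. *)
Lemma spectrum_not_orthogonal G x : spectrum mu G ->
  ~ (forall a, G a -> ft mu (x - a) = 0).
Proof.
move=> [_ [_ _ dense]] ort.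
have [X [c [XG]]] := dense _ (L2fun_cis x) 1 ltr01.
rewrite Lnorm2_lt // expr1n ltNge => /negP; apply.
have := @n2_orthogonal _ mu x X c (fun a aX => ort a (XG a aX)).
congr (_ <= n2 mu _)%E; apply/funext => y; rewrite /cis mulrA; congr (_ - _).
by apply: eq_bigr => a _; rewrite !mulrA.
Qed.

Lemma spectrum_orthogonal G a b : spectrum mu G -> G a -> G b -> a != b ->
  ft mu (a - b) = 0.
Proof.
by move=> [_ [_ ort _]] Ga Gb ab; rewrite -inner_cis ort // (negbTE ab).
Qed.

(** Density of the trigonometric polynomials reduces completeness to the approximation of
    exponentials. *)
Lemma orthonormal_basis_cis G :
  (forall a b, G a -> G b -> a != b -> ft mu (a - b) = 0) ->
  (forall x, approximable mu G (fun y => cis (x * y))) ->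
  orthonormal_basis mu G (fun (gamma y : F) => expi (2 * pi * gamma * y)).
Proof.
move=> ort app; split.
- by move=> a _; exact: L2fun_cis.
- move=> a b Ga Gb; rewrite inner_cis; have [->|ab] := eqVneq a b.
    by rewrite subrr ft0.
  exact: ort.
- move=> f hf eps e0.
  have [_ /(_ (eps ^+ 2) (exprn_gt0 2 e0))] := approximable_trans app (approximable_L2 hf).
  move=> [_ [s [sG ->]] hs].
  (* The basis property asks for a finite set of frequencies, so the coefficients of equal
     frequencies in s are added up. *)
  exists [fset c.2 | c in s]%fset, (fun a => \sum_(c <- s | c.2 == a) c.1); split.
    by move=> _ /imfsetP [c /= /sG ? ->].
  rewrite Lnorm2_lt //; move: hs; congr (n2 mu _ < _)%E; apply/funext => y.
  congr (_ - _); under [RHS]eq_bigr do rewrite mulr_suml.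
  rewrite (exchange_big_dep xpredT) //= big_seq [RHS]big_seq; apply: eq_bigr => c cs.
  rewrite -big_filter (_ : [seq a <- _ | _] = [:: c.2]); last first.
    have cX : c.2 \in [fset c.2 | c in s]%fset by apply/imfsetP; exists c.
    rewrite -(filter_pred1_uniq (fset_uniq _) cX).
    by apply: eq_filter => a /=; rewrite ?andbT eq_sym.
  by rewrite big_seq1 /cis mulrA.
Qed.

End spectral_tools.

(** A bounded orbit under the expanding maps y -> M y - c, with c in A, starts in the attractor: the
    remainder M^(-n) y_n of the expansion of y_0 tends to 0. *)
Lemma attractor_backward (F : realType) (M : nat) (A : set F)
    (y c : nat -> F) (B : F) :
  (1 < M)%N -> (forall j, A (c j)) -> (forall j, `|y j| <= B) ->
  (forall j, M%:R * y j = y j.+1 + c j) -> attractor M%:R A (y 0%N).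
Proof.
move=> M1 Ac yB rec; exists c => //.
have M0 : M%:R != 0 :> F by rewrite pnatr_eq0 -lt0n ltnW.
have M1' : 1 < M%:R :> F by rewrite ltr1n.
(* Telescoping of c_j = M y_j - y_(j+1). *)
have -> : series (fun j => M%:R ^- j.+1 * c j) = fun n => y 0%N - M%:R ^- n * y n.
  apply/funext; elim=> [|n IH]; first by rewrite /series /= big_geq // expr0 invr1 mul1r subrr.
  rewrite /series /= big_nat_recr //= -[X in X + _]/(series _ n) IH.
  have -> : c n = M%:R * y n - y n.+1 by rewrite rec addrC addKr.
  by rewrite exprS; field; rewrite M0 expf_neq0.
rewrite -[X in _ --> X]subr0; apply: cvgB; first exact: cvg_cst.
apply/norm_cvg0P/(@squeeze_cvgr _ _ _ _ (fun=> 0) (fun n => M%:R ^- n * B)).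
- apply: nearW => n; rewrite normr_ge0 normrM ger0_norm ?invr_ge0 ?exprn_ge0 //=.
  by apply: ler_wpM2l; rewrite ?invr_ge0 ?exprn_ge0.
- exact: cvg_cst.
- rewrite -[X in _ --> X](mul0r B); apply: cvgM; last exact: cvg_cst.
  under eq_fun do rewrite -exprVn; apply: cvg_expr.
  by rewrite normfV ger0_norm // invf_lt1 //; lra.
Qed.

Lemma wval_tuple (W : Type) (l : W -> nat) (M n : nat) (u : n.-tuple W) :
  wval l M u = (\sum_(j < n) M ^ j * l (tnth u j))%N.
Proof.
elim: n u => [|n IH] u; first by rewrite tuple0 big_ord0.
case/tupleP: u => w u; rewrite big_ord_recl expn0 mul1n tnth0 /= IH big_distrr /=.
by congr (_ + _)%N; apply: eq_bigr => j _; rewrite tnthS expnS mulnA.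
Qed.

(** * The self-similar measure: mask, digits and expansions as words *)

Section self_similar_spectra.
Local Open Scope complex_scope.
Variables (F : realType) (s R N q : nat) (p : 'I_s -> nat).
Variable mu : probability (measurableTypeR F) F.
Hypotheses (R_gt1 : (1 < R)%N) (N_gt1 : (1 < N)%N) (q_gt0 : (0 < q)%N)
  (p_gt0 : forall i, (0 < p i)%N)
  (p_incr : forall i j : 'I_s, (i < j)%N -> (p i < p j)%N)
  (p_ltq : forall i, (p i < q)%N).
Hypothesis mu_ss : self_similar mu (R * N ^ q)%N%:R (Dset F N p).

Let M := (R * N ^ q)%N.
Let L := [set` Lset F R N q p].
Let W := word_letter s N.
Let l : W -> nat := ldigit R q p.
Let m : F -> F[i] := mask N p.
Let val := wval l M.

Let N_gt0 : (0 < N)%N. Proof. exact: ltnW. Qed.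

Let M_gt1 : (1 < M)%N.
Proof. by apply: (leq_trans R_gt1); rewrite leq_pmulr // expn_gt0 N_gt0. Qed.

Let M_neq0 : M%:R != 0 :> F.
Proof. by rewrite pnatr_eq0 -lt0n ltnW. Qed.

Let NR_neq0 : N%:R != 0 :> F.
Proof. by rewrite pnatr_eq0 -lt0n. Qed.

Let R_neq0 : R%:R != 0 :> F.
Proof. by rewrite pnatr_eq0 -lt0n ltnW. Qed.

Let M_split i : M%:R = R%:R * N%:R ^+ (q - (pexp p i).+1) * N%:R ^+ (pexp p i).+1 :> F.
Proof. by rewrite /M natrM natrX -mulrA -exprD subnK // pexp_ltq. Qed.

Definition single_letter (i : 'I_s.+1) (c : 'I_N) : W :=
  [ffun j => if j == i then c else Ordinal N_gt0].

Lemma ldigit_single i c : l (single_letter i c) = (R * N ^ (q - (pexp p i).+1) * c)%N.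
Proof.
rewrite /l /ldigit (bigD1 i) //= ffunE eqxx big1 ?addn0 // => j ji.
by rewrite ffunE (negbTE ji) muln0.
Qed.

Let w0 : W := single_letter ord0 (Ordinal N_gt0).

Let l_w0 : l w0 = 0%N.
Proof. by rewrite ldigit_single muln0. Qed.

Let m_periodic : forall y (k : int), m (y + k%:~R) = m y.
Proof. by move=> y k; exact: mask_periodic. Qed.

Let ft_mask xi : ft mu xi = m (xi / M%:R) * ft mu (xi / M%:R).
Proof.
have cD : #|` Dset F N p| = (N ^ s.+1)%N := card_Dset F R_gt1 N_gt1 p_gt0 p_incr q_gt0.
have D0 : (0 < #|` Dset F N p|)%N by rewrite cD expn_gt0 N_gt0.
rewrite (ft_self_similar mu_ss xi D0) /m maskE cD.
by rewrite (big_Dset R_gt1 N_gt1 p_gt0 p_incr q_gt0 (fun d => cis (_ * d))).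
Qed.

Let m_eq0 y : m y = 0 -> exists k : int, M%:R * y = k%:~R.
Proof.
move=> /(mask_eq0P N_gt1) [i [k hk]].
exists ((R * N ^ (q - (pexp p i).+1))%:Z * k).
by rewrite intrM -hk (M_split i) mulrA -!natrX -natrM -natrM.
Qed.

Lemma mem_digitP y : L y <-> exists w : W, y = (l w)%:R.
Proof.
by split=> [/(mem_Lset R N_gt1 q_gt0 p_ltq)|h]; [|apply/(mem_Lset R N_gt1 q_gt0 p_ltq)].
Qed.

Lemma expansionsP x : expansions M%:R L x <-> exists u : seq W, x = (val u)%:R.
Proof.
split=> [[k [d [k1 dL ->]]]|[u ->]].
  have /choice [g hg] : forall j, exists w : W, d j = (l w)%:R by move=> j; apply/mem_digitP.
  exists [tuple g j | j < k]; rewrite /val wval_tuple natr_sum; apply: eq_bigr => j _.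
  by rewrite tnth_mktuple natrM natrX hg.
(* Expansions in Lambda are nonempty; a final zero letter covers the empty word without changing
   values. *)
have -> : val u = val (in_tuple (rcons u w0)).
  by rewrite /val /= -cats1 wval_cat /= l_w0 muln0 addn0 muln0 addn0.
exists (size (rcons u w0)), (fun j => (l (tnth (in_tuple (rcons u w0)) j))%:R).
split; first by rewrite size_rcons.
  by move=> j; apply/mem_digitP; exists (tnth (in_tuple (rcons u w0)) j).
by rewrite /val wval_tuple natr_sum; apply: eq_bigr => j _; rewrite natrM natrX.
Qed.

Lemma dilate_words t a : dilate t (expansions M%:R L) a <->
  exists u : seq W, a = t * (val u)%:R.
Proof.
split=> [[_ /expansionsP [u ->] <-]|[u ->]]; first by exists u.
by exists (val u)%:R => //; apply/expansionsP; exists u.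
Qed.

(** * Sufficiency of the conditions on t *)

Section coprime_dilation.
Variable z : int.
Hypothesis coprime_z : coprimez z N%:Z.

Let m_orthogonal (w v : W) : w != v ->
  m (z%:~R * ((l w)%:R - (l v)%:R) / M%:R) = 0.
Proof. exact: mask_ldigit. Qed.

Let m_hadamard xi :
  \sum_(w : W) sqn (m ((xi + z%:~R * (l w)%:R) / M%:R)) = 1.
Proof. exact: mask_hadamard. Qed.

Lemma ft_words_ss (u v : seq W) (y : int) : size u = size v -> u <> v ->
  ft mu (z%:~R * ((val u)%:R - (val v)%:R) + M%:R ^+ size u * y%:~R) = 0.
Proof. exact: ft_words M_gt1 m_periodic ft_mask m_orthogonal u v y. Qed.

Lemma ft_dilate_orthogonal a b : dilate z%:~R (expansions M%:R L) a ->
  dilate z%:~R (expansions M%:R L) b -> a != b -> ft mu (a - b) = 0.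
Proof.
move=> /dilate_words [u ->] /dilate_words [v ->] ab.
(* Padding each word with zeros by the length of the other gives a common length. *)
have vu : val (u ++ nseq (size v) w0) = val u.
  by rewrite /val wval_cat wval_nseq ?muln0 ?addn0.
have vv : val (v ++ nseq (size u) w0) = val v.
  by rewrite /val wval_cat wval_nseq ?muln0 ?addn0.
have := @ft_words_ss (u ++ nseq (size v) w0) (v ++ nseq (size u) w0) 0.
rewrite !size_cat !size_nseq vu vv mulr0 addr0 mulrBr; apply; first by rewrite addnC.
by move=> e; move: ab; rewrite -vu e vv eqxx.
Qed.

Hypothesis no_word : forall n : nat, (0 < n)%N ->
  `I_n #<= attractor M%:R (dilate z%:~R L) `&` range (intr : int -> F) ->
  ~ exists I : n.-tuple int,
      [/\ forall k : int, k \in I -> L k%:~R,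
          I <> [tuple 0 | j < n] &
          (M%:Z ^+ n - 1 %| z * \sum_(j < n) M%:Z ^+ j * tnth I j)%Z].

(** On a cycle, where x_n = x_0, this becomes (M^n - 1) x_0 = z sum_j M^j l(u_j). *)
Lemma cycle_sum (x : nat -> int) (u : nat -> W) n :
  (forall k, M%:Z * x k.+1 = x k + z * (l (u k))%:Z) ->
  M%:Z ^+ n * x n = x 0%N + z * \sum_(j < n) M%:Z ^+ j * (l (u j))%:Z.
Proof.
move=> rec; elim: n => [|n IH]; first by rewrite big_ord0 expr0 mul1r mulr0 addr0.
by rewrite big_ord_recr /= exprSr -mulrA rec mulrDr IH; ring.
Qed.

(** The n distinct points of the cycle lie in the attractor, so n is within the bound of [no_word];
    the word of the cycle satisfies the divisibility, hence is zero, and (M^n - 1) x_0 = 0. *)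
Lemma no_cycle_ss (n : nat) (x : nat -> int) (u : nat -> W) : (0 < n)%N ->
  (forall k, M%:Z * x k.+1 = x k + z * (l (u k))%:Z) -> x n = x 0%N ->
  (forall i j, (i < n)%N -> (j < n)%N -> x i = x j -> i = j) -> x 0%N = 0.
Proof.
move=> n0 rec xn xinj.
have sum := cycle_sum n rec.
have MZ : M%:Z ^+ n - 1 != 0.
  rewrite subr_eq0 -PoszX; apply/eqP => -[] e.
  by have := ltn_expl n M_gt1; rewrite e; case: (n) n0.
have attr i : (i < n)%N -> attractor M%:R (dilate z%:~R L) (x i)%:~R.
  move=> ni.
  (* The index b walks backwards around the cycle from i, adding n - 1 in place of subtracting 1
     modulo n. *)
  pose b j := ((i + n.-1 * j) %% n)%N.
  have bn j : (b j < n)%N by rewrite ltn_mod.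
  have bS j : (b j = (b j.+1).+1 %[mod n])%N.
    have e : (i + n.-1 * j.+1 + 1 = i + n.-1 * j + n)%N.
      by rewrite mulnS; move: (n.-1 * j)%N => a; lia.
    by rewrite /b modn_mod -addn1 modnDml e modnDr.
  have xb j : M%:Z * x (b j) = x (b j.+1) + z * (l (u (b j.+1)))%:Z.
    rewrite -rec; congr (_ * _); move: (bS j); rewrite modn_small //.
    case: (ltngtP (b j.+1).+1 n) => e.
    - by rewrite modn_small // => ->.
    - by move: e; rewrite ltnS leqNgt bn.
    - by rewrite {1}e modnn => ->; rewrite e xn.
  have -> : x i = x (b 0%N) by rewrite /b muln0 addn0 modn_small.
  apply: (@attractor_backward _ _ _ (fun j => (x (b j))%:~R)
    (fun j => z%:~R * (l (u (b j.+1)))%:R) (\sum_(k < n) `|(x k)%:~R|)) => //.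
  - move=> j; exists (l (u (b j.+1)))%:R => //.
    by apply/mem_digitP; exists (u (b j.+1)).
  - move=> j; rewrite (bigD1 (Ordinal (bn j))) //= lerDl.
    by apply: sumr_ge0.
  - by move=> j; have /(congr1 (intr : int -> F)) := xb j; rewrite intrM intrD intrM.
have card : `I_n #<= attractor M%:R (dilate z%:~R L) `&` range (intr : int -> F).
  apply: (@card_le_trans _ _ _ [set ((x i)%:~R : F) | i in `I_n]).
    have inj : {in `I_n &, injective (fun i => (x i)%:~R : F)}.
      by move=> i j; rewrite !inE /= => ni nj /intr_inj; exact: xinj.
    by have := inj_card_eq inj; rewrite card_eq_le => /andP[].
  apply: subset_card_le => _ [i /= ni <-]; split; first exact: attr.
  by exists (x i).
have dvd : (M%:Z ^+ n - 1 %| z * \sum_(j < n) M%:Z ^+ j * (l (u j))%:Z)%Z.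
  apply/dvdzP; exists (x 0%N); move: sum; rewrite xn mulrBr mulr1 mulrC => ->.
  by rewrite addrAC subrr add0r.
have I0 : [tuple (l (u j))%:Z | j < n] = [tuple 0 | j < n].
  apply: contrapT => hI; apply: (no_word n0 card); exists [tuple (l (u j))%:Z | j < n].
  split=> //.
    move=> _ /mapP [j _ ->]; apply/mem_digitP; exists (u j); by rewrite pmulrn.
  by move: dvd; under [in X in X -> _]eq_bigr => j _ do 
    rewrite -(tnth_mktuple (fun j : 'I_n => (l (u j))%:Z) j).
have l0 (j : 'I_n) : (l (u j))%:Z = 0.
  by have := congr1 (fun t => tnth t j) I0; rewrite !tnth_mktuple.
move: sum; rewrite xn big1 => [|j _]; last by rewrite l0 mulr0.
rewrite mulr0 addr0 => /eqP; rewrite -subr_eq0 -{2}[x 0%N]mul1r -mulrBl mulf_eq0.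
by rewrite (negbTE MZ) /= => /eqP.
Qed.

Lemma spectrum_coprime_dilation : spectrum mu (dilate z%:~R (expansions M%:R L)).
Proof.
split.
  have -> : dilate z%:~R (expansions M%:R L) =
      [set z%:~R * (val u)%:R | u in [set: seq W]].
    apply/seteqP; split=> a.
      by move=> /dilate_words [u ->]; exists u.
    by move=> [u _ <-]; apply/dilate_words; exists u.
  exact: sub_countable (card_image_le _ _) (countableP _).
apply: orthonormal_basis_cis; first exact: ft_dilate_orthogonal.
move=> xi; apply: (approximable_cis_words M_gt1 l_w0 m_periodic m_eq0 ft_mask
  m_orthogonal m_hadamard no_cycle_ss).
by move=> u; apply/dilate_words; exists u.
Qed.

End coprime_dilation.

(** * Necessity of the conditions on t *)

Section necessity.
Variable t : F.
Hypothesis spec : spectrum mu (dilate t (expansions M%:R L)).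

Let dilate_val (u : seq W) : dilate t (expansions M%:R L) (t * (val u)%:R).
Proof. by apply/dilate_words; exists u. Qed.

Lemma spectrum_dilation_neq0 : t != 0.
Proof.
apply/eqP => t0; (* The frequency M / N is orthogonal to the constants. *)
apply: (spectrum_not_orthogonal (x := M%:R / N%:R) spec) => a.
move=> /dilate_words [u ->]; rewrite t0 mul0r subr0 ft_mask.
have -> : m (M%:R / N%:R / M%:R) = 0; last by rewrite mul0r.
apply: (mask_eq0 N_gt1 (i := ord0) (m := 1)).
  by rewrite dvdz1 /=; move: N_gt1; case: N => [|[|]].
by rewrite pexp0 expn1 mul1r mulrAC divff // mul1r.
Qed.

Lemma spectrum_words (u v : seq W) : val u != val v ->
  ft mu (t * ((val u)%:R - (val v)%:R)) = 0.
Proof.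
move=> uv; rewrite mulrBr; apply: (spectrum_orthogonal spec) => //.
by rewrite (can_eq (mulKf spectrum_dilation_neq0)) eqr_nat.
Qed.

(** With l = R N^(q - p_s - 1) in L, orthogonality puts t l / M^(j+1) among the mask zeros k /
    N^(p_i + 1). Since M = l N^(p_s + 1) and p_i <= p_s, t = k M^j N^(p_s - p_i) is an integer. *)
Lemma spectrum_dilation_int : exists z : int, t = z%:~R.
Proof.
pose w1 : W := single_letter ord_max (Ordinal N_gt1).
have lw1 : l w1 = (R * N ^ (q - (pexp p ord_max).+1))%N by rewrite ldigit_single muln1.
have l0 : (l w1)%:R != 0 :> F by rewrite lw1 natrM natrX mulf_neq0 // expf_neq0.
have : ft mu (t * (l w1)%:R) = 0.
  have := @spectrum_words [:: w1] [::]; rewrite /val /= muln0 addn0 subr0; apply.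
  by move: l0; rewrite pnatr_eq0.
move=> /(ft_eq0 M_gt1 ft_mask) [j /(mask_eq0P N_gt1) [i [k hk]]].
have pi_max : (pexp p i <= pexp p ord_max)%N.
  have [->//|im] := eqVneq i ord_max; apply/ltnW/pexp_mono => //.
  by rewrite ltn_neqAle -ltnS ltn_ord andbT; apply: contra im => /eqP e; apply/eqP/val_inj.
exists (k * (M%:Z ^+ j * N%:Z ^+ (pexp p ord_max - pexp p i))).
have Ml : M%:R = (l w1)%:R * (N%:R ^+ (pexp p i).+1 * N%:R ^+ (pexp p ord_max - pexp p i)) :> F.
  by rewrite lw1 -exprD addSn subnKC // (M_split ord_max) natrM natrX.
have e1 : N%:R ^+ (pexp p i).+1 * (t * (l w1)%:R) = k%:~R * M%:R ^+ j.+1.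
  by rewrite -hk natrX -[RHS]mulrA divfK // expf_neq0.
have c0 : (l w1)%:R * N%:R ^+ (pexp p i).+1 != 0 :> F by rewrite mulf_neq0 ?expf_neq0.
have castX (a b : nat) : (a%:Z ^+ b)%:~R = a%:R ^+ b :> F by rewrite rmorphXn.
apply: (mulIf c0); transitivity (N%:R ^+ (pexp p i).+1 * (t * (l w1)%:R)); first ring.
rewrite e1 exprSr !intrM !castX.
by rewrite [X in _ * (_ * X) = _]Ml; ring.
Qed.

Lemma spectrum_dilation_coprime (z : int) : t = z%:~R -> coprimez z N%:Z.
Proof.
move=> tz; rewrite /coprimez; apply: contraT => g1.
pose g := gcdn `|z| N.
have g0 : (0 < g)%N by rewrite gcdn_gt0 N_gt0 orbT.
have gg1 : (1 < g)%N by move: g1; rewrite /gcdz /= -/g; move: g0; case: (g) => [|[|]].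
have [c cN] : exists c, N = (c * g)%N by apply/dvdnP/dvdn_gcdr.
have [z' zE] : exists z', z = z' * g%:Z by apply/dvdzP; rewrite dvdzE /= dvdn_gcdl.
have c0 : (0 < c)%N by move: N_gt0; rewrite cN muln_gt0 => /andP[].
have cltN : (c < N)%N by rewrite cN ltn_Pmulr.
pose wc : W := single_letter ord0 (Ordinal cltN).
have lg : (l wc * g = M)%N.
  rewrite ldigit_single pexp0 /= -!mulnA -cN; congr (R * _)%N.
  by rewrite -expnSr -subSn ?subSS ?subn0.
have lwc0 : (0 < l wc)%N.
  have : (0 < M)%N by exact: ltnW.
  by rewrite -lg muln_gt0 => /andP[].
apply: contraT => _; exfalso.
(* With g = gcd(z, N), the number M / g is a digit; its orthogonality to all the
   multiples of M makes z / g orthogonal to the whole family. *)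
apply: (spectrum_not_orthogonal (x := z'%:~R) spec) => a /dilate_words [v ->].
have := @spectrum_words [:: wc] (w0 :: v).
rewrite {1 2 3}/val /= muln0 addn0 l_w0 add0n -/(val v) => H.
have {}H : ft mu (M%:R * (z'%:~R - t * (val v)%:R)) = 0.
  rewrite -H; last first.
    (* As 0 < l(wc) < M, the number l(wc) is no multiple of M, and the two words have different
       values. *)
    apply/eqP => e; have : (l wc < M)%N by rewrite -lg ltn_Pmulr.
    rewrite e; case: (val v) e => [e|k _]; first by move: lwc0; rewrite e muln0.
    by rewrite mulnS ltnNge leq_addr.
  congr ft; rewrite tz zE natrM -lg natrM intrM; ring.
(* The mask is 1 at integers, so the zero at M times an integer passes to that integer. *)
move: H; rewrite ft_mask [M%:R * _]mulrC mulfK // tz.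
have -> : z'%:~R - z%:~R * (val v)%:R = (z' - z * (val v)%:Z)%:~R :> F by rewrite intrB intrM.
by rewrite [m _](mask_int F p N_gt1) mul1r.
Qed.

Lemma spectrum_no_word (z : int) : t = z%:~R -> forall n : nat, (0 < n)%N ->
  ~ exists I : n.-tuple int,
      [/\ forall k : int, k \in I -> L k%:~R,
          I <> [tuple 0 | j < n] &
          (M%:Z ^+ n - 1 %| z * \sum_(j < n) M%:Z ^+ j * tnth I j)%Z].
Proof.
move=> tz n n0 [I [IL I0 /dvdzP [x0 hx0]]].
have cz := spectrum_dilation_coprime tz.
have /choice [d hd] : forall j : 'I_n, exists w : W, tnth I j = (l w)%:Z.
  move=> j; have /mem_digitP [w e] := IL _ (mem_tnth j I).
  by exists w; apply: (@intr_inj F); rewrite e.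
pose u := [tuple d j | j < n].
have uE : (val u)%:Z = \sum_(j < n) M%:Z ^+ j * tnth I j.
  rewrite /val wval_tuple (big_morph Posz PoszD (erefl _)); apply: eq_bigr => j _.
  by rewrite PoszM PoszX tnth_mktuple hd.
(* Elements of L are nonnegative, so a word with a nonzero letter has positive value. *)
have u0 : (0 < val u)%N.
  rewrite lt0n; apply/eqP => e; apply: I0; apply: eq_from_tnth => j.
  rewrite tnth_mktuple hd; congr Posz; apply/eqP.
  move/eqP: e; rewrite /val wval_tuple sum_nat_eq0 => /forallP /(_ j) /=.
  by rewrite tnth_mktuple muln_eq0 expn_eq0; case: (M) M_gt1.
pose U k := flatten (nseq k (tval u)).
have sU k : size (U k) = (k * n)%N.
  by elim: k => //= k IH; rewrite size_cat size_tuple -/(U k) IH mulSn.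
have vU k : M%:Z ^+ (k * n) * x0 = x0 + z * (val (U k))%:Z.
  elim: k => [|k IH]; first by rewrite /= mulr0 addr0 mul0n expr0 mul1r.
  rewrite mulSn exprD -mulrA IH [U _]/= /val wval_cat -/val size_tuple.
  rewrite PoszD PoszM PoszX mulrDr mulrDr uE hx0; ring.
have kU k : (k <= val (U k))%N.
  elim: k => //= k IH; rewrite /val wval_cat -/val -add1n leq_add //.
  apply: leq_trans IH _; rewrite size_tuple leq_pmull // expn_gt0 ltnW //.
(* Iterating the cycle k times, - x0 = z val(u^k) modulo M^(k n), so - x0 behaves like
   an additional word. *)
apply: (spectrum_not_orthogonal (x := (- x0)%:~R) spec) => a /dilate_words [v ->].
(* This k exceeds val v, so u^k and v have different values by [kU]; it also exceeds the length of
   v, so v can be padded to length k n. *)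
pose k := (val v + size v).+1.
have szv : (size v <= k * n)%N.
  by rewrite (@leq_trans k) ?leq_pmulr // /k ltnW // ltnS leq_addl.
pose v' := v ++ nseq (k * n - size v) w0.
have vv' : val v' = val v by rewrite /val wval_cat wval_nseq ?muln0 ?addn0.
have := @ft_words_ss z cz (U k) v' (- x0).
rewrite sU size_cat size_nseq subnKC // vv' => H.
rewrite -[RHS]H //; last first.
  move=> e; have := kU k; rewrite e vv' /k ltnNge leq_addr //.
congr ft; rewrite tz.
have := congr1 (intr : int -> F) (vU k).
rewrite intrM intrD intrM rmorphXn /= => e.
by rewrite intrN mulrN e mulrBr opprD; ring.
Qed.

End necessity.

End self_similar_spectra.

(** * The characterization of the spectra t Lambda *)

Theorem theorem1p2 (F : realType) (s R N q : nat) (p : 'I_s -> nat)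
  (mu : probability (measurableTypeR F) F) (t : F)
  (s_ge1 : (1 <= s)%N) (R_gt1 : (1 < R)%N) (N_gt1 : (1 < N)%N)
  (q_gt0 : (0 < q)%N) (p_gt0 : forall i, (0 < p i)%N)
  (coRN : coprime R N)
  (p_incr : forall i j : 'I_s, (i < j)%N -> (p i < p j)%N)
  (p_ltq : forall i, (p i < q)%N)
  (mu_ss : self_similar mu (R * N ^ q)%N%:R (Dset F N p)) :
  let M := (R * N ^ q)%N in
  let L := [set` Lset F R N q p] in
  let Lambda := expansions M%:R L in
  spectrum mu (dilate t Lambda) <->
  exists z : int,
    [/\ t = z%:~R, coprimez z N%:Z &
      forall n : nat, (0 < n)%N ->
        `I_n #<= attractor M%:R (dilate t L) `&` range (intr : int -> F) ->
        ~ exists I : n.-tuple int,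
            [/\ forall l : int, l \in I -> L l%:~R,
                I <> [tuple 0 | j < n] &
                (M%:Z ^+ n - 1 %|
                   z * \sum_(j < n) M%:Z ^+ j * tnth I j)%Z]].
Proof.
move=> M L Lambda; split=> [spec|[z [-> cz hz]]]; last first.
  exact: (spectrum_coprime_dilation R_gt1 N_gt1 q_gt0 p_gt0 p_incr p_ltq mu_ss cz hz).
have [z tz] := spectrum_dilation_int R_gt1 N_gt1 q_gt0 p_gt0 p_incr p_ltq mu_ss spec.
exists z; split=> //.
  exact: (spectrum_dilation_coprime R_gt1 N_gt1 q_gt0 p_gt0 p_incr p_ltq mu_ss spec tz).
move=> n n0 _.
exact: (spectrum_no_word R_gt1 N_gt1 q_gt0 p_gt0 p_incr p_ltq mu_ss spec tz n0).
Qed.
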